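(* Consider the following integral operators on functions on $(0,\infty)$: $$U_3f(x)=f(x)+\int_0^x f(y)\,\frac{dy}{y},\qquad U_4f(x)=f(x)+\frac{1}{x}\int_x^\infty f(y)\,dy,$$ $$U_5f(x)=f(x)+3x\int_0^x f(y)\,\frac{dy}{y^2},\qquad U_6f(x)=f(x)-\frac{3}{x^2}\int_0^x y f(y)\,dy,$$ $$U_7f(x)=f(x)+\frac{3}{x^2}\int_x^\infty y f(y)\,dy,\qquad U_8f(x)=f(x)-3x\int_x^\infty f(y)\,\frac{dy}{y^2},$$ $$U_9f(x)=f(x)+\frac12\int_0^x\left(\frac{15x^2}{y^3}-\frac{3}{y}\right)f(y)\,dy,\qquad U_{10}f(x)=f(x)+\frac12\int_x^\infty\left(\frac{15y^2}{x^3}-\frac{3}{x}\right)f(y)\,dy.$$ Then $(U_3,U_4)$, $(U_5,U_6)$, $(U_7,U_8)$ and $(U_9,U_{10})$ are pairs of unitary mutually inverse operators in $L_2(0,\infty)$.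
   Context: $L_2(0,\infty)$ carries Lebesgue measure. Each operator $U$ above is considered on the domain $\{f\in C_c^\infty(0,\infty): Uf\in L_2(0,\infty)\}$. It is called unitary in $L_2(0,\infty)$ if it extends from this domain to a unitary operator on $L_2(0,\infty)$. ''Mutually inverse'' refers to these unitary extensions. *)

(* Defs.v *)
(* MathComp-Analysis, with [R[i]] from mathcomp-real-closed. *)
From mathcomp Require Import all_boot all_order all_algebra.
From mathcomp Require Import complex.
From mathcomp Require Import all_classical all_reals all_analysis.

Set Implicit Arguments.
Unset Strict Implicit.
Unset Printing Implicit Defensive.
Import Order.TTheory GRing.Theory Num.Theory.
Import numFieldNormedType.Exports.

Local Open Scope classical_set_scope.
Local Open Scope ring_scope.
Local Open Scope complex_scope.

(* A complex function on (0, oo) is represented by a total function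
   [R -> R[i]]; everything below except [Cc_infty] ignores its values outside
   [half_line]. *)
Definition half_line (R : realType) : set R := `]0, +oo[.
Arguments half_line {R}.

(* [R[i]] carries no measurable structure in the library, so measurability and
   integrals of complex functions are taken componentwise. *)
Definition cmeasurable (R : realType) (D : set R) (f : R -> R[i]) : Prop :=
  measurable_fun D (fun x => complex.Re (f x)) /\
  measurable_fun D (fun x => complex.Im (f x)).

Definition cintegral (R : realType) (D : set R) (f : R -> R[i]) : R[i] :=
  (\int[@lebesgue_measure R]_(x in D) complex.Re (f x)) +i*
  (\int[@lebesgue_measure R]_(x in D) complex.Im (f x)).

Definition L2 (R : realType) (f : R -> R[i]) : Prop :=
  cmeasurable half_line f /\
  (\int[@lebesgue_measure R]_(x in half_line)
     ((ComplexField.Normc.normc (f x)) ^+ 2)%:E < +oo)%E.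

(* Equality in L_2(0, oo). *)
Definition eqL2 (R : realType) (f g : R -> R[i]) : Prop :=
  ae_eq (@lebesgue_measure R) half_line f g.

Definition dotL2 (R : realType) (f g : R -> R[i]) : R[i] :=
  cintegral half_line (fun x => f x * (g x)^*).

(* Functions in C_c^oo(0, oo), extended by zero to the whole line: smooth on R
   with support in some [[a, b]], [0 < a]. *)
Definition smooth (R : realType) (f : R -> R) : Prop :=
  forall (n : nat) (x : R), derivable (derive1n n f) x 1.

Definition Cc_infty (R : realType) (f : R -> R[i]) : Prop :=
  [/\ smooth (fun x => complex.Re (f x)),
      smooth (fun x => complex.Im (f x)) &
      exists a b : R, 0 < a /\ forall x, f x != 0 -> a <= x <= b].

Definition operator (R : realType) : Type := (R -> R[i]) -> (R -> R[i]).

(* A unitary operator on L_2(0, oo), acting on representatives: well defined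
   on classes, linear, inner-product preserving and onto. *)
Record unitaryL2 (R : realType) (V : operator R) : Prop := UnitaryL2 {
  unitaryL2_stable : forall f, L2 f -> L2 (V f);
  unitaryL2_eq : forall f g, L2 f -> L2 g -> eqL2 f g -> eqL2 (V f) (V g);
  unitaryL2_linear : forall (c : R[i]) f g, L2 f -> L2 g ->
    eqL2 (V (fun x => c * f x + g x)) (fun x => c * V f x + V g x);
  unitaryL2_dot : forall f g, L2 f -> L2 g -> dotL2 (V f) (V g) = dotL2 f g;
  unitaryL2_onto : forall g, L2 g -> exists2 f, L2 f & eqL2 (V f) g }.

Definition in_domain (R : realType) (U : operator R) (f : R -> R[i]) : Prop :=
  Cc_infty f /\ L2 (U f).

Definition unitary_extension (R : realType) (U V : operator R) : Prop :=
  unitaryL2 V /\ forall f, in_domain U f -> eqL2 (V f) (U f).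

Definition is_unitary (R : realType) (U : operator R) : Prop :=
  exists V, unitary_extension U V.

Definition mutually_inverse (R : realType) (V W : operator R) : Prop :=
  forall f, L2 f -> eqL2 (V (W f)) f /\ eqL2 (W (V f)) f.

(* The last clause ranges over all unitary extensions, so that it does not
   depend on a choice of extension. *)
Definition unitary_mutually_inverse (R : realType) (U U' : operator R) : Prop :=
  [/\ is_unitary U, is_unitary U' &
      forall V V', unitary_extension U V -> unitary_extension U' V' ->
        mutually_inverse V V'].

Section Operators.
Variable R : realType.
Implicit Types (f : R -> R[i]) (x y : R).

Definition U3 f x : R[i] :=
  f x + cintegral `]0, x[ (fun y => (y^-1)%:C * f y).

Definition U4 f x : R[i] :=
  f x + (x^-1)%:C * cintegral `]x, +oo[ f.

Definition U5 f x : R[i] :=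
  f x + (3 * x)%:C * cintegral `]0, x[ (fun y => ((y ^+ 2)^-1)%:C * f y).

Definition U6 f x : R[i] :=
  f x - (3 / x ^+ 2)%:C * cintegral `]0, x[ (fun y => y%:C * f y).

Definition U7 f x : R[i] :=
  f x + (3 / x ^+ 2)%:C * cintegral `]x, +oo[ (fun y => y%:C * f y).

Definition U8 f x : R[i] :=
  f x - (3 * x)%:C * cintegral `]x, +oo[ (fun y => ((y ^+ 2)^-1)%:C * f y).

Definition U9 f x : R[i] :=
  f x + (2^-1)%:C *
    cintegral `]0, x[ (fun y => (15 * x ^+ 2 / y ^+ 3 - 3 / y)%:C * f y).

Definition U10 f x : R[i] :=
  f x + (2^-1)%:C *
    cintegral `]x, +oo[ (fun y => (15 * y ^+ 2 / x ^+ 3 - 3 / x)%:C * f y).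

End Operators.

(* Main.v *)
(* For an integer [k] let [F] be the primitive of [y^k f] on (0, oo) that vanishes
   at 0 if [k >= 0] and at [oo] if [k < 0], and let
     [hardy k f x = f x - (2k+1) x^(-k-1) F x].
   The Mellin multiplier of [hardy k] is [(s-k)/(s+k+1)], of modulus 1 on the line
   Re s = -1/2. Concretely, for [f] continuous with compact support in (0, oo),
     [(hardy k f)^2 - f^2 = - (2k+1) d/dx (x^(-2k-1) F^2)],
     [x^(-k-1) hardy k f = d/dx (x^(-2k-1) F)],
   so that [hardy k] is a contraction for the L2 norm and [hardy (-k-1)] is its
   inverse. Both facts extend to L2 by density, and two contractions inverse to each
   other are isometries. If [U_i f] is in L2, the moments [int y^k f] by which
   [U_i f] differs from a product of operators [hardy k] have to vanish, and the
   functions of [C_c^oo] with vanishing moments are dense, which makes the unitary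
   extension unique:
     U3 = hardy (-1), U4 = hardy 0, U5 = U8 = hardy (-2), U6 = U7 = hardy 1,
     U9 = hardy (-3) hardy (-1), U10 = hardy 0 hardy 2. *)
Require Import Defs.
From mathcomp Require Import all_boot all_order all_algebra.
From mathcomp Require Import complex ring lra zify finmap.
From mathcomp Require Import all_classical all_reals all_analysis measurable_realfun.

Set Implicit Arguments.
Unset Strict Implicit.
Unset Printing Implicit Defensive.
Import Order.TTheory GRing.Theory Num.Theory.
Import numFieldNormedType.Exports HBNNSimple.

Local Open Scope classical_set_scope.
Local Open Scope ring_scope.

(** * Square integrable real functions on a measurable set *)

(** For an integer [k] the number [2k+1] is never 0, so [y^k] is square integrable at exactly one
    end of the half line, and [F] is normalised to vanish at that end. By Cauchy-Schwarz [F x] is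
    then a bounded functional of [f] in L2, so [hardy k] is given on all of L2 by the same integral
    formula; density only carries over norm bounds and identities. The coefficients of [U9] are
    residues: the product of the multipliers of [hardy (-3)] and [hardy (-1)] is (s+3)(s+1)/((s-2)s)
    = 1 + (15/2)/(s-2) - (3/2)/s, and [U10] belongs to the inverse product. The moments must vanish
    because the excess of [U_i f] over the Hardy product is a combination of 1, x, x^2, which is too
    large at infinity, or of x^-1, x^-2, x^-3, which is too large at 0. This costs no density
    because each moment is an unbounded functional for the L2 norm. *)

Section RealL2.
Context {R : realType}.
Local Notation mu := (@lebesgue_measure R).
Implicit Types (A B : set R) (f g h : R -> R).

Lemma aeS (P Q : R -> Prop) : (forall x, P x -> Q x) ->
  (\forall x \ae mu, P x) -> \forall x \ae mu, Q x.
Proof.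
exact: (@filterS _ _ (@ae_filter_ringOfSetsType _ (measurableTypeR R) R mu)).
Qed.

Lemma aeS2 (P P' Q : R -> Prop) : (forall x, P x -> P' x -> Q x) ->
  (\forall x \ae mu, P x) -> (\forall x \ae mu, P' x) ->
  \forall x \ae mu, Q x.
Proof.
exact: (@filterS2 _ _ (@ae_filter_ringOfSetsType _ (measurableTypeR R) R mu)).
Qed.

Definition rL2 A f : Prop :=
  measurable_fun A f /\ mu.-integrable A (EFin \o (fun x => f x ^+ 2)).

(** [Rintegral] sends an infinite integral to 0, so a bound on [nrm A f] is informative only
    together with [rL2 A f]; several lemmas below deliver the two jointly. *)
Definition nrm A f : R := Num.sqrt (\int[mu]_(x in A) (f x ^+ 2)).

Lemma rL2_integrableM A f g : measurable A -> rL2 A f -> rL2 A g ->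
  mu.-integrable A (EFin \o (fun x => f x * g x)).
Proof.
move=> mA [mf f2] [mg g2].
apply: (le_integrable _ _ _ (integrableD _ f2 g2)) => //.
  by apply/measurable_EFinP; exact: measurable_funM.
move=> x Ax /=; rewrite lee_fin [leRHS]ger0_norm ?addr_ge0 ?sqr_ge0//.
rewrite ler_norml; apply/andP; split; nra.
Qed.

Lemma rL2D A f g : measurable A -> rL2 A f -> rL2 A g ->
  rL2 A (fun x => f x + g x).
Proof.
move=> mA Lf Lg; have fg := rL2_integrableM mA Lf Lg.
case: Lf Lg => mf f2 [mg g2]; split; first exact: measurable_funD.
have mA' : @measurable _ (measurableTypeR R) A by [].
have := integrableD mA' (integrableD mA' f2 g2) (integrableZl mA' 2 fg).
apply: eq_integrable => // x _ /=; rewrite -!EFinM -!EFinD; congr EFin; ring.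
Qed.

Lemma rL2Z A (c : R) f : measurable A -> rL2 A f -> rL2 A (fun x => c * f x).
Proof.
move=> mA [mf f2]; split; first exact: measurable_funM.
have mA' : @measurable _ (measurableTypeR R) A by [].
have := integrableZl mA' (c ^+ 2) f2.
by apply: eq_integrable => // x _ /=; rewrite -!EFinM exprMn.
Qed.

Lemma rL2_lin A (c : R) f g : measurable A -> rL2 A f -> rL2 A g ->
  rL2 A (fun x => c * f x + g x).
Proof. by move=> mA Lf Lg; apply: (rL2D mA (rL2Z c mA Lf)). Qed.

Lemma rL2B A f g : measurable A -> rL2 A f -> rL2 A g ->
  rL2 A (fun x => f x - g x).
Proof.
move=> mA Lf Lg; have := rL2_lin (-1) mA Lg Lf.
by under eq_fun do rewrite mulN1r addrC.
Qed.

Lemma rL2S A B f : measurable A -> measurable B -> B `<=` A ->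
  rL2 A f -> rL2 B f.
Proof.
move=> mA mB BA [mf f2]; split; first exact: measurable_funS mf.
exact: integrableS f2.
Qed.

Lemma rL2_eq A f g : {in A, f =1 g} -> rL2 A f -> rL2 A g.
Proof.
move=> fg [mf f2]; split; first exact: eq_measurable_fun mf.
apply/integrableP; move/integrableP: f2 => [m2 lt2]; split.
  by apply: eq_measurable_fun m2 => x Ax /=; rewrite fg.
by under eq_integral => x Ax do rewrite /= -(fg x Ax).
Qed.

Lemma nrm_ge0 A f : 0 <= nrm A f. Proof. exact: sqrtr_ge0. Qed.

Lemma Rintegral_sqr_ge0 A f : 0 <= \int[mu]_(x in A) (f x ^+ 2).
Proof. by apply: Rintegral_ge0 => x _; exact: sqr_ge0. Qed.

Lemma sqr_nrm A f : nrm A f ^+ 2 = \int[mu]_(x in A) (f x ^+ 2).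
Proof. by rewrite sqr_sqrtr// Rintegral_sqr_ge0. Qed.

Lemma eq_nrm A f g : {in A, f =1 g} -> nrm A f = nrm A g.
Proof. by move=> fg; congr Num.sqrt; apply: eq_Rintegral => x /fg ->. Qed.

Lemma Rintegral_lin A (a b : R) f g : measurable A ->
  mu.-integrable A (EFin \o f) -> mu.-integrable A (EFin \o g) ->
  \int[mu]_(x in A) (a * f x + b * g x) =
  a * \int[mu]_(x in A) f x + b * \int[mu]_(x in A) g x.
Proof.
move=> mA If Ig; have mA' : @measurable _ (measurableTypeR R) A by [].
rewrite -!RintegralZl// RintegralD//.
- exact: (integrableZl mA' a If).
- exact: (integrableZl mA' b Ig).
Qed.

Lemma integrable_lin A (a b : R) f g : measurable A ->
  mu.-integrable A (EFin \o f) -> mu.-integrable A (EFin \o g) ->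
  mu.-integrable A (EFin \o (fun x => a * f x + b * g x)).
Proof.
move=> mA If Ig.
have mA' : @measurable _ (measurableTypeR R) A by [].
have := integrableD mA' (integrableZl mA' a If) (integrableZl mA' b Ig).
by apply: eq_integrable.
Qed.

Lemma sqr_nrmD A (c : R) f g : measurable A -> rL2 A f -> rL2 A g ->
  nrm A (fun x => c * f x + g x) ^+ 2 =
  c ^+ 2 * nrm A f ^+ 2 + 2 * c * \int[mu]_(x in A) (f x * g x) +
  nrm A g ^+ 2.
Proof.
move=> mA Lf Lg; have fg := rL2_integrableM mA Lf Lg.
rewrite !sqr_nrm; transitivity (\int[mu]_(x in A)
   (1 * (c ^+ 2 * f x ^+ 2 + 2 * c * (f x * g x)) + 1 * g x ^+ 2)).
  by apply: eq_Rintegral => x _; ring.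
rewrite Rintegral_lin ?mul1r//; [|apply: integrable_lin => //|].
- by rewrite Rintegral_lin//; case: Lf.
- by case: Lf.
- by case: Lg.
Qed.

Lemma CauchySchwarz_L2 A f g : measurable A -> rL2 A f -> rL2 A g ->
  `|\int[mu]_(x in A) (f x * g x)| <= nrm A f * nrm A g.
Proof.
move=> mA Lf Lg; set I := Rintegral _ _ _.
have H (c : R) : 0 <= c ^+ 2 * nrm A f ^+ 2 + 2 * c * I + nrm A g ^+ 2.
  by rewrite -sqr_nrmD// sqr_ge0.
rewrite -(@ler_pXn2r _ 2)// ?nnegrE ?mulr_ge0 ?nrm_ge0// real_normK ?num_real//.
have := nrm_ge0 A f; rewrite le_eqVlt => /predU1P[n0|n0]; last first.
  (* The minimiser of the quadratic polynomial in [c]. *)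
  have := H (- I / nrm A f ^+ 2).
  have n20 : 0 < nrm A f ^+ 2 by rewrite exprn_gt0.
  have -> : (- I / nrm A f ^+ 2) ^+ 2 * nrm A f ^+ 2 +
     2 * (- I / nrm A f ^+ 2) * I + nrm A g ^+ 2 =
     (nrm A f ^+ 2 * nrm A g ^+ 2 - I ^+ 2) / nrm A f ^+ 2.
    by field; rewrite gt_eqF.
  by rewrite pmulr_lge0 ?invr_gt0// subr_ge0 exprMn.
have [-> |I0] := eqVneq I 0; first by rewrite expr0n/= sqr_ge0.
(* When [nrm A f = 0] the polynomial is affine in [c], and this [c] gives it the value -1. *)
have := H (- (nrm A g ^+ 2 + 1) / (2 * I)).
have -> : (- (nrm A g ^+ 2 + 1) / (2 * I)) ^+ 2 * nrm A f ^+ 2 +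
     2 * (- (nrm A g ^+ 2 + 1) / (2 * I)) * I + nrm A g ^+ 2 = -1.
  by rewrite -n0; field.
by rewrite lerNr oppr0 ler10.
Qed.

Lemma ler_nrmD A f g : measurable A -> rL2 A f -> rL2 A g ->
  nrm A (fun x => f x + g x) <= nrm A f + nrm A g.
Proof.
move=> mA Lf Lg.
rewrite -(@ler_pXn2r _ 2)// ?nnegrE ?addr_ge0 ?nrm_ge0//.
have := sqr_nrmD 1 mA Lf Lg; under eq_fun do rewrite mul1r.
move=> ->; have := CauchySchwarz_L2 mA Lf Lg; rewrite ler_norml => /andP[_].
set I := Rintegral _ _ _; nra.
Qed.

Lemma nrmZ A (c : R) f : measurable A -> rL2 A f ->
  nrm A (fun x => c * f x) = `|c| * nrm A f.
Proof.
move=> mA [mf f2]; apply/eqP; rewrite -(@eqrXn2 _ 2)// ?mulr_ge0 ?nrm_ge0//.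
apply/eqP; rewrite exprMn real_normK ?num_real// !sqr_nrm -RintegralZl//.
by apply: eq_Rintegral => x _; rewrite exprMn.
Qed.

Lemma nrmN A f : nrm A (fun x => - f x) = nrm A f.
Proof. by congr Num.sqrt; apply: eq_Rintegral => x _; rewrite sqrrN. Qed.

Lemma ler_nrmB A f g : measurable A -> rL2 A f -> rL2 A g ->
  nrm A (fun x => f x - g x) <= nrm A f + nrm A g.
Proof.
move=> mA Lf Lg; have := rL2Z (-1) mA Lg; rewrite -(nrmN A g).
under eq_fun do rewrite mulN1r.
exact: ler_nrmD.
Qed.

Lemma sub_nrm A B f : measurable A -> measurable B -> B `<=` A -> rL2 A f ->
  nrm B f <= nrm A f.
Proof.
move=> mA mB BA [mf f2]; rewrite ler_wsqrtr//.
have mA' : @measurable _ (measurableTypeR R) A by [].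
have mB' : @measurable _ (measurableTypeR R) B by [].
have f2B := integrableS mA' mB' BA f2.
rewrite fine_le//; first exact: (integrable_fin_num mB').
  exact: (integrable_fin_num mA').
apply: ge0_subset_integral => //; first by case/integrableP : f2.
by move=> x _; rewrite lee_fin sqr_ge0.
Qed.

Lemma rL2_ae A f g : measurable A -> measurable_fun A g ->
  f = g %[ae mu in A] -> rL2 A f -> rL2 A g /\ nrm A g = nrm A f.
Proof.
move=> mA mg fg [mf f2].
have m2 : measurable_fun A (EFin \o (fun x => f x ^+ 2)).
  by case/integrableP: f2.
have m2' : measurable_fun A (EFin \o (fun x => g x ^+ 2)).
  by apply/measurable_EFinP; exact: measurable_funX.
have E : (\int[mu]_(x in A) (g x ^+ 2)%:E = \int[mu]_(x in A) (f x ^+ 2)%:E)%E.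
  by apply: ae_eq_integral => //; apply: aeS fg => x /[apply] /= ->.
split; last by rewrite /nrm /Rintegral E.
split=> //; apply/integrableP; split=> //.
move/integrableP : f2 => [_]; congr (_ < _)%E.
apply: ae_eq_integral => //; try exact: measurableT_comp.
by apply: aeS fg => x /[apply] /= ->.
Qed.

Lemma nrm_eq0 A f : measurable A -> rL2 A f -> nrm A f = 0 ->
  f = (fun=> 0) %[ae mu in A].
Proof.
move=> mA [mf f2] n0.
have m2 : measurable_fun A (EFin \o (fun x => f x ^+ 2)).
  by case/integrableP: f2.
have : (\int[mu]_(x in A) `|(EFin \o (fun x => f x ^+ 2)%R) x| = 0)%E.
  have := sqr_nrm A f; rewrite n0 expr0n /= => /esym/eqP.
  rewrite /Rintegral fine_eq0 ?integrable_fin_num// => /eqP <-.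
  by apply: eq_integral => x _ /=; rewrite ger0_norm ?sqr_ge0.
have mA' : @measurable _ (measurableTypeR R) A by [].
move/(ae_eq_integral_abs mu mA' m2); apply: aeS => x /[apply] /= -[] /eqP.
by rewrite sqrf_eq0 => /eqP.
Qed.

Lemma rL2_le A f g : measurable A -> measurable_fun A f -> rL2 A g ->
  (forall x, A x -> `|f x| <= `|g x|) -> rL2 A f /\ nrm A f <= nrm A g.
Proof.
move=> mA mf [mg g2] fg.
have mA' : @measurable _ (measurableTypeR R) A by [].
have sqr_le x : A x -> f x ^+ 2 <= g x ^+ 2.
  by move=> Ax; rewrite -[leLHS]real_normK ?num_real// -[leRHS]real_normK
    ?num_real// lerXn2r ?nnegrE ?fg.
have f2 : mu.-integrable A (EFin \o (fun x => f x ^+ 2)).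
  apply: (@le_integrable _ (measurableTypeR R) R mu A mA' _ _ _ _ g2).
    by apply/measurable_EFinP; exact: measurable_funX.
  by move=> x Ax /=; rewrite lee_fin !ger0_norm ?sqr_ge0// sqr_le.
by split=> //; rewrite ler_wsqrtr//; apply: le_Rintegral.
Qed.

(** Dominated convergence for [f] cut off outside [B n], with dominating function [|f|]. *)
Lemma cvg_Rintegral_exhaust A (B : (set R)^nat) f :
  measurable A -> (forall n, measurable (B n)) -> (forall n, B n `<=` A) ->
  (forall x, A x -> \forall n \near \oo, B n x) ->
  mu.-integrable A (EFin \o f) ->
  \int[mu]_(x in B n) f x @[n --> \oo] --> \int[mu]_(x in A) f x.
Proof.
move=> mA mB BA AB If.
have mA' : @measurable _ (measurableTypeR R) A by [].
have mB' n : @measurable _ (measurableTypeR R) (B n) by exact: mB.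
apply: fine_cvg; rewrite fineK ?(integrable_fin_num mA')//.
pose g n := (EFin \o f) \_ (B n).
have -> : (fun n => \int[mu]_(x in B n) (f x)%:E)%E =
          (fun n => \int[mu]_(x in A) g n x)%E.
  by apply/funext => n; rewrite -(integral_mkcondr mu A (B n)) setIidr.
apply: (@dominated_cvg _ (measurableTypeR R) R mu A mA' g _ (fun x => `|f x|%:E)).
- move=> n; rewrite /g -measurable_restrict//; apply: measurable_funS mA' _ _ => //.
  by case/integrableP: If.
- move=> x Ax; apply: cvg_near_cst; apply: filterS (AB x Ax) => n Bx.
  by rewrite /g patchE mem_set.
- by [].
- exact: integrable_norm.
- move=> n x Ax; rewrite /g patchE; case: ifP => _ //=.
  by rewrite normr0 lee_fin.
Qed.

(** Fatou's lemma for the squares cut off outside [B n]: a bound on windows, uniform in [n], becomes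
    a bound on the whole set. *)
Lemma rL2_exhaust A (B : (set R)^nat) f (c : R) :
  measurable A -> (forall n, measurable (B n)) -> (forall n, B n `<=` A) ->
  (forall x, A x -> \forall n \near \oo, B n x) ->
  measurable_fun A f -> (forall n, rL2 (B n) f) ->
  (\forall n \near \oo, nrm (B n) f <= c) ->
  rL2 A f /\ nrm A f <= c.
Proof.
move=> mA mB BA AB mf Lf Lc.
have mA' : @measurable _ (measurableTypeR R) A by [].
have mB' n : @measurable _ (measurableTypeR R) (B n) by exact: mB.
have c0 : 0 <= c.
  by case: Lc => N _ /(_ N (leqnn N)); apply: le_trans; exact: nrm_ge0.
pose g n := (fun x => (f x ^+ 2)%:E) \_ (B n).
have mf2 : measurable_fun A (fun x => (f x ^+ 2)%:E).
  by apply/measurable_EFinP; exact: measurable_funX.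
have g0 n x : A x -> (0 <= g n x)%E.
  by move=> Ax; rewrite /g patchE; case: ifP => _ //; rewrite lee_fin sqr_ge0.
have mg n : measurable_fun A (g n).
  rewrite /g -measurable_restrict//.
  by apply: measurable_funS mA' _ _ => //; apply: subIsetl.
have := @fatou _ (measurableTypeR R) R mu A mA' g mg g0.
have -> : (\int[mu]_(x in A) limn_einf (g^~ x) = \int[mu]_(x in A) (f x ^+ 2)%:E)%E.
  apply: eq_integral => x; rewrite inE => Ax.
  suff /cvg_limn_einf_sup[] : g^~ x @ \oo --> (f x ^+ 2)%:E by [].
  apply: cvg_near_cst; apply: filterS (AB x Ax) => n Bx.
  by rewrite /g patchE mem_set.
have le_c : (limn_einf (fun n => \int[mu]_(x in A) g n x) <= (c ^+ 2)%:E)%E.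
  rewrite limn_einf_lim; apply: lime_le; first exact: is_cvg_einfs.
  apply: filterS Lc => n Lc; apply: (@le_trans _ _ (\int[mu]_(x in A) g n x)%E).
    by apply: ereal_inf_lbound; exists n => /=.
  rewrite -(integral_mkcondr mu A (B n)) setIidr//.
  have [_ If] := Lf n.
  have := Lc; rewrite -(@ler_pXn2r _ 2)// ?nnegrE ?nrm_ge0// sqr_nrm -lee_fin.
  by rewrite /Rintegral fineK// (integrable_fin_num (mB' n)).
move=> /le_trans /(_ le_c) fc.
have If : mu.-integrable A (EFin \o (fun x => f x ^+ 2)).
  apply/integrableP; split=> //; under eq_integral do rewrite /= ger0_norm ?sqr_ge0//.
  by rewrite (le_lt_trans fc) ?ltry.
split=> //; rewrite -(@ler_pXn2r _ 2)// ?nnegrE ?nrm_ge0// sqr_nrm.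
by rewrite -lee_fin /Rintegral fineK// (integrable_fin_num mA').
Qed.

End RealL2.

(** * Integer powers and the operators [hardy k] *)

Section Powers.
Context {R : realType}.
Local Notation mu := (@lebesgue_measure R).
Implicit Types (A B : set R) (f g G : R -> R) (k : int) (x y : R).

Lemma is_derive_exprz k x : x != 0 ->
  is_derive x 1 (fun y => y ^ k) (k%:~R * x ^ (k - 1)).
Proof.
have dX n : is_derive x 1 (fun y => y ^+ n) (n%:R * x ^+ n.-1).
  have -> : (fun y : R => y ^+ n) = (@id R) ^+ n by rewrite exprfctE.
  by apply: is_derive_eq; rewrite /GRing.scale/= mulr1.
move=> x0; case: k => n.
  case: n => [|n]; first by have := dX 0; rewrite !mul0r.
  have := dX n.+1; rewrite /= -pmulrn; congr is_derive; congr (_ * _).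
  by have -> : n.+1%:Z - 1 = n by lia.
rewrite [X in is_derive _ _ X _](_ : _ = fun y => (y ^+ n.+1)^-1)//.
have xn0 : x ^+ n.+1 != 0 by rewrite expf_neq0.
have := @is_deriveV R (fun y => y ^+ n.+1) _ _ _ xn0 (dX n.+1); congr is_derive; rewrite /GRing.scale /=.
have -> : Negz n - 1 = Negz n.+1 by lia.
rewrite !NegzE mulrNz -!exprnN -pmulrn (exprSr _ n.+1) (exprSr _ n).
by field; rewrite x0 expf_neq0.
Qed.

Lemma continuous_exprz k x : x != 0 -> {for x, continuous (fun y => y ^ k)}.
Proof.
move=> x0; apply/differentiable_continuous/derivable1_diffP.
by have [] := is_derive_exprz k x0.
Qed.

Lemma is_derive_continuous f x df : is_derive x 1 f df -> {for x, continuous f}.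
Proof. by case=> fx _; apply/differentiable_continuous/derivable1_diffP. Qed.

Lemma is_derive1Z c f x df :
  is_derive x 1 f df -> is_derive x 1 (fun y => c * f y) (c * df).
Proof. by move=> dfx; exact: is_deriveZ. Qed.

Lemma is_derive1M f g x df dg : is_derive x 1 f df -> is_derive x 1 g dg ->
  is_derive x 1 (fun y => f y * g y) (df * g x + f x * dg).
Proof.
move=> dfx dgx; apply: is_derive_eq.
by rewrite /GRing.scale /= addrC [g x * _]mulrC.
Qed.

Lemma is_derive1B f g x df dg : is_derive x 1 f df -> is_derive x 1 g dg ->
  is_derive x 1 (fun y => f y - g y) (df - dg).
Proof. by move=> dfx dgx; exact: is_deriveB. Qed.

Lemma derivative_itv G g a b : a < b ->
  (forall x, a <= x <= b -> is_derive x 1 G (g x)) ->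
  (forall x, a <= x <= b -> {for x, continuous g}) ->
  \int[mu]_(x in `[a, b]) g x = G b - G a.
Proof.
move=> ab dG cg; rewrite /Rintegral (@continuous_FTC2 _ g G)//.
- by apply: continuous_in_subspaceT => x; rewrite inE/= in_itv/= => /cg.
- split.
  + by move=> x; rewrite in_itv/= => /andP[/ltW ax /ltW xb]; have [] := dG x; rewrite ?ax.
  + apply: cvg_at_right_filter; apply: (is_derive_continuous (dG a _)).
    by rewrite lexx ltW.
  + apply: cvg_at_left_filter; apply: (is_derive_continuous (dG b _)).
    by rewrite lexx ltW.
- move=> x; rewrite in_itv/= => /andP[/ltW ax /ltW xb].
  by rewrite derive1E; apply: derive_val; apply: dG; rewrite ax.
Qed.

Lemma integrable_continuous g A a b : measurable A -> A `<=` `[a, b] ->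
  (forall x, a <= x <= b -> {for x, continuous g}) ->
  mu.-integrable A (EFin \o g).
Proof.
move=> mA Aab cg; apply: (@integrableS _ (measurableTypeR R) R mu `[a, b]%classic) => //.
apply: continuous_compact_integrable; first exact: segment_compact.
by apply: continuous_in_subspaceT => x; rewrite inE/= in_itv/= => /cg.
Qed.

Lemma measurable_half_line : measurable (@half_line R).
Proof. exact: measurable_itv. Qed.

Lemma measurable_continuous g :
  (forall x, 0 < x -> {for x, continuous g}) -> measurable_fun half_line g.
Proof.
move=> cg; apply: open_continuous_measurable_fun; first exact: interval_open.
by move=> x; rewrite inE /half_line/= in_itv/= andbT => /cg.
Qed.

Lemma rL2_continuous g A a b : measurable A -> 0 < a -> A `<=` `[a, b] ->
  (forall x, 0 < x -> {for x, continuous g}) -> rL2 A g.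
Proof.
move=> mA a0 Aab cg; split.
  apply: measurable_funS (measurable_continuous cg); first exact: measurable_half_line.
  move=> x /Aab; rewrite /half_line /= !in_itv/= andbT => /andP[ax _].
  exact: lt_le_trans ax.
apply: integrable_continuous Aab _ => // x /andP[ax _].
by apply: continuousM; [apply: cg; exact: lt_le_trans ax|apply: cg; exact: lt_le_trans ax].
Qed.

(** The part of the half line between [x] and the end at which [y ^ k] is square integrable: 0 if
    [2k+1 > 0], infinity if [2k+1 < 0]. *)
Definition tail k x : set R := if 0 <= k then `]0, x[%classic else `]x, +oo[%classic.

(** The sign makes [y ^ k * f y] the derivative in both cases. *)
Definition prim k f x : R :=
  (if 0 <= k then 1 else -1) * \int[mu]_(y in tail k x) (y ^ k * f y).

Definition hardy k f x : R :=
  f x - (2 * k + 1)%:~R * x ^ (- k - 1) * prim k f x.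

Lemma measurable_tail k x : measurable (tail k x).
Proof. by rewrite /tail; case: ifP => _; exact: measurable_itv. Qed.

Lemma tail_half_line k x : 0 < x -> tail k x `<=` half_line.
Proof.
move=> x0 y; rewrite /tail /half_line; case: ifP => _ /=; rewrite !in_itv/= !andbT.
  by case/andP.
exact: lt_trans.
Qed.

Lemma subset_tail k x y : 0 < x -> x <= y ->
  (0 <= k -> tail k x `<=` tail k y) /\ (k < 0 -> tail k y `<=` tail k x).
Proof.
move=> x0 xy; rewrite /tail; split=> k0.
  by rewrite k0 => z; rewrite /= !in_itv/= => /andP[-> zx] /=; exact: lt_le_trans xy.
rewrite leNgt k0/= => z; rewrite /= !in_itv/= !andbT; exact: le_lt_trans.
Qed.

Lemma rL2_exprz_tail k x : 0 < x -> rL2 (tail k x) (fun y => y ^ k).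
Proof.
move=> x0; have xn0 : x != 0 by rewrite gt_eqF.
have mH := measurable_tail k x.
have mf : measurable_fun (tail k x) (fun y : R => y ^ k).
  apply: (@measurable_funS _ _ _ _ half_line); [exact: measurable_half_line|exact: tail_half_line|].
  by apply: measurable_continuous => y y0; apply: continuous_exprz; rewrite gt_eqF.
have [k0|k0] := leP 0 k.
  split=> //; move: k0 mf mH; rewrite /tail => k0; rewrite k0; case: k k0 => [n|//] _ mf mH.
  apply: (@integrable_continuous _ _ 0 x) => //.
    by apply: subset_itv_oo_cc.
  move=> y _; rewrite (_ : (fun _ => _) = (fun y : R => y ^+ (n * 2))).
    exact: exprn_continuous.
  by apply/funext => z; rewrite exprM.
have /andP[A B] : (2 * k + 1 < 0) && (2 * k + 1 != 0) by lia.
have kn0 : ((2 * k + 1)%:~R : R) != 0 by rewrite intr_eq0.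
suff : rL2 (tail k x) (fun y => y ^ k) /\ nrm (tail k x) (fun y => y ^ k) <=
    Num.sqrt (- (2 * k + 1)%:~R^-1 * x ^ (2 * k + 1)) by case.
have ck y : x <= y <= y -> {for y, continuous (fun y : R => y ^ k * y ^ k)}.
  move=> /andP[xy _]; apply: continuousM; apply: continuous_exprz;
  by rewrite gt_eqF// (lt_le_trans x0).
apply: (@rL2_exhaust R _ (fun n => `]x, x + n.+1%:R[%classic)) => //.
- by move=> n y; rewrite /tail leNgt k0/= !in_itv/= andbT => /andP[].
- move=> y; rewrite /tail leNgt k0/= in_itv/= andbT => xy.
  near=> n; rewrite /= in_itv/= xy/= -ltrBlDl.
  apply: (@lt_trans _ _ n%:R); last by rewrite ltr_nat.
  by near: n; exact: nbhs_infty_gtr.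
- move=> n; apply: (@rL2_continuous _ _ x (x + n.+1%:R)) => //.
  + by apply: subset_itv_oo_cc.
  + by move=> y y0; apply: continuous_exprz; rewrite gt_eqF.
- apply: nearW => n; rewrite ler_wsqrtr//.
  have xn : x < x + n.+1%:R by rewrite ltrDl.
  rewrite Rintegral_itv_bndo_bndc; last first.
    apply: (@integrable_continuous _ _ x (x + n.+1%:R)); first exact: measurable_itv.
      exact: subset_itv_oo_cc.
    by move=> y /andP[xy _]; apply: ck; rewrite xy/=.
  rewrite Rintegral_itv_obnd_cbnd; last first.
    apply: (@integrable_continuous _ _ x (x + n.+1%:R)); first exact: measurable_itv.
      exact: subset_itv_oc_cc.
    by move=> y /andP[xy _]; apply: ck; rewrite xy/=.
  (* An antiderivative of [y ^ (2k)]. Its value at the far endpoint is nonpositive; dropping it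
     leaves the bound [- G x], uniform in [n]. *)
  pose G y : R := (2 * k + 1)%:~R^-1 * y ^ (2 * k + 1).
  have -> : \int[mu]_(y in `[x, x + n.+1%:R]) ((y ^ k) ^+ 2) = G (x + n.+1%:R) - G x.
    apply: derivative_itv => // y /andP[xy _]; last by apply: ck; rewrite xy/=.
    have yn0 : y != 0 by rewrite gt_eqF// (lt_le_trans x0).
    have := is_derive1Z ((2 * k + 1)%:~R^-1 : R) (is_derive_exprz (2 * k + 1) yn0).
    congr is_derive; rewrite mulrA mulVf// mul1r.
    by rewrite exprnP exprz_exp; congr exprz; lia.
  rewrite /G lerBlDl mulNr subrr mulr_le0_ge0//.
    by rewrite invr_le0 ltW// ltrz0.
  by rewrite exprz_ge0// ltW// (lt_trans x0).
Unshelve. all: by end_near. Qed.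

End Powers.

(** * Primitives of compactly supported functions *)

Section Prim.
Context {R : realType}.
Local Notation mu := (@lebesgue_measure R).
Implicit Types (A B : set R) (f g G : R -> R) (k : int) (x y : R).

Lemma integrable_prim k f x : 0 < x -> rL2 half_line f ->
  mu.-integrable (tail k x) (EFin \o (fun y => y ^ k * f y)).
Proof.
move=> x0 Lf; have mT := measurable_tail k x.
apply: rL2_integrableM => //; first exact: rL2_exprz_tail.
exact: (rL2S measurable_half_line mT (tail_half_line x0)).
Qed.

(** Cauchy-Schwarz on the tail. The value of [prim k f] at a point thus depends continuously on [f]
    in L2, on which the later passages to the limit rest. *)
Lemma ler_norm_prim k f x : 0 < x -> rL2 half_line f ->
  `|prim k f x| <= nrm (tail k x) (fun y => y ^ k) * nrm half_line f.
Proof.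
move=> x0 Lf; have mT := measurable_tail k x.
have -> : `|prim k f x| = `|\int[mu]_(y in tail k x) (y ^ k * f y)|.
  by rewrite /prim normrM; case: ifP => _; rewrite ?normrN normr1 mul1r.
have LfT := rL2S measurable_half_line mT (tail_half_line x0) Lf.
apply: le_trans (CauchySchwarz_L2 mT (rL2_exprz_tail _ x0) LfT) _.
apply: ler_wpM2l; first exact: nrm_ge0.
apply: (sub_nrm measurable_half_line mT) => //; exact: tail_half_line.
Qed.

Lemma prim_lin k c f g x : 0 < x -> rL2 half_line f -> rL2 half_line g ->
  prim k (fun y => c * f y + g y) x = c * prim k f x + prim k g x.
Proof.
move=> x0 Lf Lg; rewrite /prim mulrCA -mulrDr; congr (_ * _).
rewrite -[X in _ = _ + X]mul1r -Rintegral_lin ?integrable_prim//; last exact: measurable_tail.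
by apply: eq_Rintegral => y _; ring.
Qed.

Lemma hardy_lin k c f g x : 0 < x -> rL2 half_line f -> rL2 half_line g ->
  hardy k (fun y => c * f y + g y) x = c * hardy k f x + hardy k g x.
Proof. by move=> x0 Lf Lg; rewrite /hardy prim_lin//; ring. Qed.

Lemma prim_ae k f g x : 0 < x -> measurable_fun half_line f ->
  measurable_fun half_line g -> f = g %[ae mu in half_line] ->
  prim k f x = prim k g x.
Proof.
move=> x0 mf mg fg; rewrite /prim; congr (_ * _); congr fine.
have mT : @measurable _ (measurableTypeR R) (tail k x) := measurable_tail k x.
have mpow (h : R -> R) : measurable_fun half_line h ->
    measurable_fun (tail k x) (fun y => (y ^ k * h y)%:E).
  move=> mh; apply/measurable_EFinP; apply: measurable_funM.
    by case: (rL2_exprz_tail k x0).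
  by apply: measurable_funS mh; [exact: measurable_half_line|exact: tail_half_line].
apply: ae_eq_integral => //; [exact: mpow|exact: mpow|].
by apply: aeS fg => y fg /(tail_half_line x0) /fg ->.
Qed.

(** An integer power is monotone on (0, oo) in a direction given by the sign of [k]; the sum of the
    two end values covers both directions. *)
Lemma ler_exprz_itv r X k x : 0 < r -> r <= x <= X -> x ^ k <= r ^ k + X ^ k.
Proof.
move=> r0 /andP[rx xX]; have x0 := lt_le_trans r0 rx; have X0 := lt_le_trans x0 xX.
case: k => n.
  by rewrite -!exprnP -[leLHS]add0r lerD ?exprn_ge0 ?(ltW r0)// lerXn2r ?nnegrE// ltW.
rewrite NegzE -!exprnN -[leLHS]addr0 lerD ?invr_ge0 ?exprn_ge0 ?(ltW X0)//.
by rewrite lef_pV2 ?posrE ?exprn_gt0// lerXn2r ?nnegrE// ltW.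
Qed.

(** The norm of [y ^ k] over the tail is monotone in [x], so on [[r, X]] it is dominated by one of
    the end values [N r], [N X]. *)
Lemma hardy_bound k r X : 0 < r -> r <= X -> exists2 C, 0 <= C &
  forall f x, rL2 half_line f -> r <= x <= X ->
    `|hardy k f x - f x| <= C * nrm half_line f.
Proof.
move=> r0 rX; pose N x := nrm (tail k x) (fun y => y ^ k).
have X0 := lt_le_trans r0 rX.
exists (`|(2 * k + 1)%:~R| * (r ^ (- k - 1) + X ^ (- k - 1)) * (N r + N X)).
  by rewrite !mulr_ge0 ?normr_ge0 ?addr_ge0 ?nrm_ge0 ?exprz_ge0// ltW.
move=> f x Lf /[dup] rxX /andP[rx xX]; have x0 := lt_le_trans r0 rx.
have := ler_norm_prim k x0 Lf; rewrite /hardy addrAC subrr add0r normrN.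
move: (prim k f x) => P PN; rewrite !normrM -!mulrA ler_wpM2l//.
have xk0 : 0 <= x ^ (- k - 1) by rewrite exprz_ge0// ltW.
apply: ler_pM => //; first by rewrite (ger0_norm xk0); exact: ler_exprz_itv.
apply: (le_trans PN); apply: ler_wpM2r; first exact: nrm_ge0.
have [k0|k0] := leP 0 k.
  rewrite -[leLHS]add0r lerD ?nrm_ge0//.
  apply: (sub_nrm (measurable_tail _ _) (measurable_tail _ _)).
    exact: (subset_tail k x0 xX).1.
  exact: rL2_exprz_tail.
rewrite -[leLHS]addr0 lerD ?nrm_ge0//.
apply: (sub_nrm (measurable_tail _ _) (measurable_tail _ _)).
  exact: (subset_tail k r0 rx).2.
exact: rL2_exprz_tail.
Qed.

(** The class in which the explicit computations take place: all moments exist, and it contains the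
    real and imaginary parts of [Cc_infty] functions. *)
Definition continuous_cpt f :=
  continuous f /\ exists a b, 0 < a /\ forall x, f x != 0 -> a <= x <= b.

Lemma integrable_cpt k f : continuous_cpt f ->
  mu.-integrable half_line (EFin \o (fun y => y ^ k * f y)).
Proof.
case=> cf [a [b [a0 fab]]].
have Iab : mu.-integrable `[a, b]%classic (EFin \o (fun y => y ^ k * f y)).
  apply: (@integrable_continuous _ _ _ a b) => // x /andP[ax _].
  by apply: continuousM; [apply: continuous_exprz; rewrite gt_eqF// (lt_le_trans a0)|exact: cf].
apply: (@integrableS _ (measurableTypeR R) R mu setT) => //; first exact: measurable_half_line.
apply: (@eq_integrable _ (measurableTypeR R) R mu setT _ ((EFin \o (fun y => y ^ k * f y)) \_ `[a, b])) => //.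
  move=> x _; rewrite patchE /=; case: ifPn => // /negP xab.
  have [->|/fab abx] := eqVneq (f x) 0; first by rewrite mulr0.
  by exfalso; apply: xab; rewrite inE/= in_itv.
by apply/(@integrable_mkcond _ (measurableTypeR R) R mu `[a, b]%classic).
Qed.

Lemma rL2_cpt f : continuous_cpt f -> rL2 half_line f.
Proof.
move=> /[dup] cf [cf' [a [b [a0 fab]]]]; split.
  by apply: measurable_continuous => x _; exact: cf'.
have cff : continuous_cpt (fun x => f x * f x).
  split=> [x|]; first by apply: continuousM; exact: cf'.
  by exists a, b; split=> // x; rewrite mulf_eq0 orbb => /fab.
have := integrable_cpt 0 cff; apply: eq_integrable; first exact: measurable_half_line.
by move=> x _ /=; rewrite expr0z mul1r.
Qed.

Lemma integrable_half_lineS A h : measurable A -> A `<=` half_line ->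
  mu.-integrable half_line (EFin \o h) -> mu.-integrable A (EFin \o h).
Proof.
move=> mA AH; apply: (@integrableS _ (measurableTypeR R) R mu) => //.
exact: measurable_half_line.
Qed.

Lemma itv_half_line b x : `]0, x[ `<=` half_line /\ [set` Interval (BRight 0) (BSide b x)] `<=` half_line.
Proof.
by split=> y; rewrite /half_line /= !in_itv/= andbT => /andP[].
Qed.

Definition moment k f : R := \int[mu]_(y in half_line) (y ^ k * f y).

Lemma Rintegral_tail_above k f x : continuous_cpt f -> 0 < x ->
  \int[mu]_(y in `]x, +oo[) (y ^ k * f y) =
  moment k f - \int[mu]_(y in `]0, x[) (y ^ k * f y).
Proof.
move=> cf x0; have If := integrable_cpt k cf.
rewrite -(@Rintegral_itvB _ _ (BRight 0) +oo%O x) //.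
- rewrite Rintegral_itv_bndo_bndc//.
  by apply: integrable_half_lineS If => //; exact: (itv_half_line true x).1.
- by rewrite bnd_simp ltW.
Qed.

Lemma primE k f x : continuous_cpt f -> 0 < x ->
  prim k f x = \int[mu]_(y in `]0, x[) (y ^ k * f y) - (if k < 0 then moment k f else 0).
Proof.
move=> cf x0; rewrite /prim /tail ltNge; case: ifP => k0 /=.
  by rewrite mul1r subr0.
by rewrite Rintegral_tail_above// mulN1r opprB.
Qed.

(** By [primE] both kinds of primitive are integrals from 0 up to a constant, so one use of the
    fundamental theorem of calculus covers both signs of [k]. *)
Lemma is_derive_prim k f x : continuous_cpt f -> 0 < x ->
  is_derive x 1 (prim k f) (x ^ k * f x).
Proof.
move=> cf x0; have If := integrable_cpt k cf.
pose I y := \int[mu]_(t in [set` Interval (BRight 0) (BRight y)]) (t ^ k * f t).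
have [||||dI dIE] := @continuous_FTC1 R (fun t => t ^ k * f t) (BRight 0) x (x + 1).
- by rewrite ltrDl.
- by apply: integrable_half_lineS If => //; exact: (itv_half_line false _).2.
- exact: x0.
- by apply: continuousM; [apply: continuous_exprz; rewrite gt_eqF|exact: cf.1].
have dI1 : is_derive x 1 I (x ^ k * f x) by apply: DeriveDef => //; rewrite -derive1E.
apply: (@near_eq_is_derive _ _ _ (fun y => I y - (if k < 0 then moment k f else 0))).
  near=> y; have y0 : 0 < y by near: y; exact: lt_nbhsr.
  rewrite primE// Rintegral_itv_bndo_bndc//.
  by apply: integrable_half_lineS If => //; exact: (itv_half_line true y).1.
have := is_derive1B dI1 (is_derive_cst (if k < 0 then moment k f else 0) x 1).
by rewrite subr0.
Unshelve. all: by end_near. Qed.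

(** Here the tail misses the support of [f]. *)
Lemma prim_eq0 k f x a b : continuous_cpt f -> 0 < x ->
  (forall y, f y != 0 -> a <= y <= b) -> (if 0 <= k then x <= a else b <= x) ->
  prim k f x = 0.
Proof.
move=> cf x0 fab kx; rewrite /prim /Rintegral (@eq_integral _ _ _ _ _ (cst 0%E)) ?integral0 ?mulr0//.
move=> y; rewrite inE /tail => xy /=.
have [->|/fab/andP[ay yb]] := eqVneq (f y) 0; first by rewrite mulr0.
move: xy kx; case: ifP => _; rewrite /= in_itv/= ?andbT.
  by move=> /andP[_ yx] xa; have := lt_le_trans yx xa; rewrite ltNge ay.
by move=> xy bx; have := le_lt_trans bx xy; rewrite ltNge yb.
Qed.

(** Here the tail contains the whole support of [f]. *)
Lemma prim_cst k f x a b : 0 < x ->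
  (forall y, f y != 0 -> a <= y <= b) -> (if 0 <= k then b < x else x < a) ->
  prim k f x = (if 0 <= k then 1 else -1) * moment k f.
Proof.
move=> x0 fab kx; congr (_ * _).
rewrite /moment [LHS]Rintegral_mkcond [RHS]Rintegral_mkcond.
apply: eq_Rintegral => y _; rewrite !patchE.
have [->|/fab/andP[ay yb]] := eqVneq (f y) 0; first by rewrite mulr0 !if_same.
congr (if _ then _ else _); apply/idP/idP; rewrite !inE; first exact: tail_half_line.
rewrite /half_line /tail; move: kx; case: ifP => _ kx /=; rewrite !in_itv/= !andbT.
  by move=> ->; exact: le_lt_trans kx.
by move=> _; exact: lt_le_trans ay.
Qed.

Lemma continuous_hardy k f x : continuous_cpt f -> 0 < x ->
  {for x, continuous (hardy k f)}.
Proof.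
move=> cf x0; apply: continuousB; first exact: cf.1.
apply: continuousM; last exact: is_derive_continuous (is_derive_prim k cf x0).
by apply: continuousM; [exact: cst_continuous|apply: continuous_exprz; rewrite gt_eqF].
Qed.

Lemma is_derive_prim_exprz k f x : continuous_cpt f -> 0 < x ->
  is_derive x 1 (fun y => y ^ (- 2 * k - 1) * prim k f y)
    (x ^ (- k - 1) * hardy k f x).
Proof.
move=> cf x0; have xn0 : x != 0 by rewrite gt_eqF.
have := is_derive1M (is_derive_exprz (- 2 * k - 1) xn0) (is_derive_prim k cf x0).
congr is_derive; rewrite /hardy.
have -> : x ^ (-2 * k - 1) = x ^ (- k - 1) * x ^ (- k).
  by rewrite -expfzDr//; congr exprz; lia.
have -> : x ^ (-2 * k - 1 - 1) = x ^ (- k - 1) * x ^ (- k - 1).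
  by rewrite -expfzDr//; congr exprz; lia.
have E : x ^ (- k) * x ^ k = 1 by rewrite -expfzDr// addNr expr0z.
have -> : (-2 * k - 1)%:~R = - (2 * k + 1)%:~R :> R by rewrite -intrN; congr intmul; lia.
rewrite [X in _ + X](_ : _ = x ^ (- k - 1) * (x ^ (- k) * x ^ k) * f x); last ring.
by rewrite E; ring.
Qed.

Lemma is_derive_prim_sqr k f x : continuous_cpt f -> 0 < x ->
  is_derive x 1 (fun y => - (2 * k + 1)%:~R * (y ^ (- 2 * k - 1) * prim k f y ^+ 2))
    (hardy k f x ^+ 2 - f x ^+ 2).
Proof.
move=> cf x0; have xn0 : x != 0 by rewrite gt_eqF.
have dF := is_derive_prim k cf x0.
have := is_derive1Z (- (2 * k + 1)%:~R) (is_derive1M (is_derive_prim_exprz k cf x0) dF).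
have -> : (fun y => - (2 * k + 1)%:~R * (y ^ (-2 * k - 1) * prim k f y * prim k f y))
  = (fun y => - (2 * k + 1)%:~R * (y ^ (-2 * k - 1) * prim k f y ^+ 2)).
  by apply/funext => y; rewrite expr2 !mulrA.
congr is_derive; rewrite /hardy.
have -> : x ^ (-2 * k - 1) = x ^ (- k - 1) * x ^ (- k).
  by rewrite -expfzDr//; congr exprz; lia.
have E : x ^ (- k) * x ^ k = 1 by rewrite -expfzDr// addNr expr0z.
transitivity (- (2 * k + 1)%:~R * (x ^ (- k - 1) *
   (f x - (2 * k + 1)%:~R * x ^ (- k - 1) * prim k f x) * prim k f x +
   x ^ (- k - 1) * (x ^ (- k) * x ^ k) * prim k f x * f x)); first ring.
by rewrite E; ring.
Qed.

End Prim.

(** * The operators [hardy k] on compactly supported functions *)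

Section HardyCpt.
Context {R : realType}.
Local Notation mu := (@lebesgue_measure R).
Implicit Types (A B : set R) (f g G : R -> R) (k : int) (x y : R).

(** The compact windows run from [n.+2^-1] to [n.+2]; the shift by 2 keeps them nondegenerate
    already at [n = 0]. *)
Lemma near_window x : 0 < x -> \forall n \near \oo, (n.+2%:R^-1 : R) < x < n.+2%:R.
Proof.
move=> x0; near=> n.
have : x^-1 < n%:R by near: n; exact: nbhs_infty_gtr.
have xn : x < n%:R by near: n; exact: nbhs_infty_gtr.
have n2 : (n%:R : R) <= n.+2%:R by rewrite ler_nat leqW// leqW.
move=> xVn; rewrite (lt_le_trans xn)// andbT invf_plt ?posrE//.
exact: lt_le_trans n2.
Unshelve. all: by end_near. Qed.

Lemma near_gtr_natr2 x : \forall n \near \oo, x < n.+2%:R.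
Proof.
near=> n; have xn : x < n%:R by near: n; exact: nbhs_infty_gtr.
by rewrite (lt_le_trans xn)// ler_nat leqW// leqW.
Unshelve. all: by end_near. Qed.

Lemma cvg_invr_natr2 : (n.+2%:R^-1 : R) @[n --> \oo] --> (0 : R).
Proof.
apply/cvgrPdist_lt => e e0; apply: filterS (near_window e0) => n /andP[ne _].
by rewrite sub0r normrN ger0_norm.
Qed.

Lemma window_half_line n : `[n.+2%:R^-1, n.+2%:R]%classic `<=` @half_line R.
Proof.
move=> x; rewrite /half_line /= !in_itv/= andbT => /andP[nx _].
by apply: lt_le_trans nx; rewrite invr_gt0.
Qed.

Lemma ltr_window n : (n.+2%:R^-1 : R) < n.+2%:R.
Proof. by apply: (@lt_trans _ _ 1); rewrite ?invf_lt1// ltr1n. Qed.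

Lemma half_line_window x : half_line x ->
  \forall n \near \oo, `[n.+2%:R^-1, n.+2%:R]%classic x.
Proof.
rewrite /half_line /= in_itv/= andbT => x0.
by apply: filterS (near_window x0) => n /andP[nx xn]; rewrite /= in_itv/= !ltW.
Qed.

Lemma hardy_contraction_cpt k f : continuous_cpt f ->
  rL2 half_line (hardy k f) /\ nrm half_line (hardy k f) <= nrm half_line f.
Proof.
move=> /[dup] cf [cf' [a [b [a0 fab]]]].
have ch x : 0 < x -> {for x, continuous (hardy k f)} by exact: continuous_hardy.
apply: (@rL2_exhaust R _ (fun n => `[n.+2%:R^-1, n.+2%:R]%classic)).
- exact: measurable_half_line.
- by move=> n; exact: measurable_itv.
- exact: window_half_line.
- exact: half_line_window.
- exact: measurable_continuous.
- by move=> n; apply: (@rL2_continuous _ _ _ n.+2%:R^-1 n.+2%:R); rewrite ?invr_gt0.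
near=> n.
have /andP[na _] : (n.+2%:R^-1 : R) < a < n.+2%:R by near: n; exact: near_window.
have nb : b < n.+2%:R by near: n; exact: near_gtr_natr2.
have r0 : 0 < n.+2%:R^-1 :> R by rewrite invr_gt0.
have X0 : 0 < n.+2%:R :> R by [].
apply: (@le_trans _ _ (nrm `[n.+2%:R^-1, n.+2%:R]%classic f)); last first.
  apply: sub_nrm; [exact: measurable_half_line|exact: measurable_itv|
    exact: window_half_line|exact: rL2_cpt].
rewrite ler_wsqrtr// -subr_ge0 -opprB oppr_ge0.
have pos x : n.+2%:R^-1 <= x -> 0 < x by exact: lt_le_trans.
have I2 g : (forall x, 0 < x -> {for x, continuous g}) ->
  mu.-integrable `[n.+2%:R^-1, n.+2%:R] (EFin \o (fun x => g x ^+ 2)).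
  by move=> cg; case: (@rL2_continuous _ g `[n.+2%:R^-1, n.+2%:R]%classic n.+2%:R^-1 n.+2%:R).
rewrite -RintegralB//; [|exact: I2|by apply: I2 => x _; exact: cf'].
pose G y := - (2 * k + 1)%:~R * (y ^ (- 2 * k - 1) * prim k f y ^+ 2).
rewrite (_ : Rintegral _ _ _ = G n.+2%:R - G n.+2%:R^-1); last first.
  apply: derivative_itv; first exact: ltr_window.
    by move=> x /andP[/pos x0 _]; exact: is_derive_prim_sqr.
  move=> x /andP[/pos x0 _]; apply: continuousB; apply: continuousM; try exact: ch; exact: cf'.
have pw x : 0 < x -> 0 <= x ^ (- 2 * k - 1) * prim k f x ^+ 2.
  by move=> x0; rewrite mulr_ge0 ?sqr_ge0// exprz_ge0// ltW.
(* The boundary term vanishes at the end where [prim k f] does. The other one is [- (2k+1)] times a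
   nonnegative number at the upper end for [k >= 0], and [2k+1] times one at the lower end for
   [k < 0]: nonpositive either way. *)
have [k0|k0] := leP 0 k.
  rewrite /G (@prim_eq0 _ k f n.+2%:R^-1 a b)// ?k0/= ?(ltW na)// expr0n/= !mulr0 subr0.
  by rewrite mulr_le0_ge0 ?pw// oppr_le0 ler0z; lia.
have F0 : prim k f n.+2%:R = 0.
  by apply: (@prim_eq0 _ k f _ a b) => //; rewrite [0 <= k]leNgt k0/= ltW.
rewrite /G F0 expr0n/= !mulr0 sub0r.
by rewrite oppr_le0 mulr_ge0 ?pw// oppr_ge0 lerz0; lia.
Unshelve. all: by end_near. Qed.

(** A sequence tending to the end of the half line at which [prim k] vanishes. *)
Definition tail_end k n : R := if 0 <= k then n.+2%:R^-1 else n.+2%:R.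

(** An antiderivative is fixed by its limit at one end. The main instances are [g = hardy m f],
    whose support is not compact, so the integral over the tail is reached as a limit over the
    truncated tails [B n]. *)
Lemma prim_antiderivative k g G x : 0 < x ->
  (forall y, 0 < y -> is_derive y 1 G (y ^ k * g y)) ->
  (forall y, 0 < y -> {for y, continuous g}) -> rL2 half_line g ->
  G (tail_end k n) @[n --> \oo] --> 0 -> prim k g x = G x.
Proof.
move=> x0 dG cg Lg G0.
have cu y : 0 < y -> {for y, continuous (fun y => y ^ k * g y)}.
  by move=> y0; apply: continuousM; [apply: continuous_exprz; rewrite gt_eqF|exact: cg].
pose B n := if 0 <= k then `]n.+2%:R^-1, x[%classic else `]x, n.+2%:R[%classic.
have mB n : measurable (B n) by rewrite /B; case: ifP => _; exact: measurable_itv.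
have n0 n : 0 < n.+2%:R^-1 :> R by rewrite invr_gt0.
have cvgI : \int[mu]_(y in B n) (y ^ k * g y) @[n --> \oo] -->
    \int[mu]_(y in tail k x) (y ^ k * g y).
  apply: cvg_Rintegral_exhaust => //; first exact: measurable_tail.
  - move=> n y; rewrite /B /tail; case: ifP => _ /=; rewrite !in_itv/= ?andbT.
      by move=> /andP[ny ->]; rewrite (lt_trans _ ny).
    by case/andP.
  - move=> y Ty; have y0 : 0 < y by have := tail_half_line x0 Ty; rewrite /half_line /= in_itv/= andbT.
    apply: filterS (near_window y0) => n /andP[ny yn]; move: Ty; rewrite /B /tail.
    case: ifP => _ /=; rewrite !in_itv/= ?andbT; first by move=> /andP[_ ->]; rewrite ny.
    by move=> ->.
  - exact: integrable_prim.
have E : \forall n \near \oo, (if 0 <= k then 1 else -1) *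
    \int[mu]_(y in B n) (y ^ k * g y) = G x - G (tail_end k n).
  apply: filterS (near_window x0) => n /andP[nx xn]; rewrite /B /tail_end.
  have oo_cc r X : r < X -> 0 < r ->
      \int[mu]_(y in `]r, X[) (y ^ k * g y) = G X - G r.
    move=> rX r0; have pos y : r <= y -> 0 < y by exact: lt_le_trans.
    rewrite Rintegral_itv_bndo_bndc; last first.
      apply: (@integrable_continuous _ _ _ r X); first exact: measurable_itv.
        exact: subset_itv_oo_cc.
      by move=> y /andP[/pos y0 _]; exact: cu.
    rewrite Rintegral_itv_obnd_cbnd; last first.
      apply: (@integrable_continuous _ _ _ r X); first exact: measurable_itv.
        exact: subset_itv_oc_cc.
      by move=> y /andP[/pos y0 _]; exact: cu.
    by apply: derivative_itv => // y /andP[/pos y0 _]; [exact: dG|exact: cu].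
  by case: ifP => _; rewrite oo_cc// ?mul1r// mulN1r opprB.
have H1 : (if 0 <= k then 1 else -1) * \int[mu]_(y in B n) (y ^ k * g y)
   @[n --> \oo] --> prim k g x by apply: cvgMr.
have H2 : (if 0 <= k then 1 else -1) * \int[mu]_(y in B n) (y ^ k * g y)
   @[n --> \oo] --> G x - 0.
  apply: cvg_trans (cvgB (cvg_cst (G x)) G0).
  by apply: near_eq_cvg; apply: filterS E => n ->.
by rewrite (cvg_unique _ H1 H2) ?subr0.
Qed.

Lemma hardyK_cpt k f x : continuous_cpt f -> 0 < x ->
  hardy (- k - 1) (hardy k f) x = f x.
Proof.
move=> /[dup] cf [cf' [a [b [a0 fab]]]] x0; rewrite {1}/hardy.
pose G y := y ^ (- 2 * k - 1) * prim k f y.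
have -> : prim (- k - 1) (hardy k f) x = G x.
  apply: prim_antiderivative => //.
  - by move=> y y0; exact: is_derive_prim_exprz.
  - by move=> y y0; exact: continuous_hardy.
  - by have [] := hardy_contraction_cpt k cf.
  (* [tail_end (- k - 1)] runs to the end opposite to that of [k]. Beyond the support [prim k f] is
     the constant [c] there, while the power factor of [G] equals [n.+2^-1] to the exponent
     [|2k+1| > 0]. *)
  pose c := (if 0 <= k then 1 else -1) * moment k f.
  have c0 : (n.+2%:R^-1 : R) ^+ absz (2 * k + 1) * c @[n --> \oo] --> 0.
    rewrite -(mul0r c); apply: cvgMl.
    have <- : (0 : R) ^+ absz (2 * k + 1) = 0.
      by rewrite expr0n; case: eqP => //; lia.
    by apply: (@cvg_comp _ _ _ _ (fun y : R => y ^+ absz (2 * k + 1)) _ _ _ cvg_invr_natr2); exact: exprn_continuous.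
  apply: cvg_trans c0; apply: near_eq_cvg; near=> n.
  have /andP[na _] : (n.+2%:R^-1 : R) < a < n.+2%:R by near: n; exact: near_window.
  have nb : b < n.+2%:R by near: n; exact: near_gtr_natr2.
  have r0 : 0 < n.+2%:R^-1 :> R by rewrite invr_gt0.
  rewrite /G /tail_end /c; have [k0|k0] := leP 0 k.
    have -> : (0 <= - k - 1) = false by lia.
    rewrite (@prim_cst _ k f n.+2%:R a b)// ?k0//; congr (_ * _).
    by rewrite exprVn exprnN; congr exprz; lia.
  have -> : (0 <= - k - 1) = true.
    lia.
  rewrite (@prim_cst _ k f n.+2%:R^-1 a b)// ?leNgt ?k0//=; congr (_ * _).
  by rewrite exprnP; congr exprz; lia.
rewrite /hardy /G (_ : 2 * (- k - 1) + 1 = - (2 * k + 1)); last lia.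
have -> : x ^ (-2 * k - 1) = x ^ (- k - 1) * x ^ (- k).
  by rewrite -expfzDr ?gt_eqF//; congr exprz; lia.
have -> : x ^ (- (- k - 1) - 1) = x ^ k by congr exprz; lia.
have E : x ^ k * x ^ (- k) = 1 by rewrite -expfzDr ?gt_eqF// subrr expr0z.
rewrite [X in _ - X](_ : _ = - (2 * k + 1)%:~R * x ^ (- k - 1) * (x ^ k * x ^ (- k)) * prim k f x).
  by rewrite E; ring.
by rewrite intrN; ring.
Unshelve. all: by end_near. Qed.

(** The partial fraction expansion of [(s-k)(s-m) / ((s+k+1)(s+m+1))], written for operators. The
    sign condition lets [prim k f] and [prim m f] vanish near the same end. *)
Lemma hardy_hardy_cpt k m f x : (0 <= k) = (0 <= m) -> k != m ->
  continuous_cpt f -> 0 < x ->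
  hardy k (hardy m f) x = f x + (k + m + 1)%:~R / (k - m)%:~R *
   ((2 * m + 1)%:~R * x ^ (- m - 1) * prim m f x -
    (2 * k + 1)%:~R * x ^ (- k - 1) * prim k f x).
Proof.
move=> km0 km /[dup] cf [cf' [a [b [a0 fab]]]] x0; rewrite {1}/hardy.
have kmR : (k - m)%:~R != 0 :> R by rewrite intr_eq0 subr_eq0.
pose d := (2 * m + 1)%:~R / (k - m)%:~R : R.
(* Integration by parts: [y ^ (k-m) * prim m f y - prim k f y] has derivative
   [(k-m) * y ^ (k-m-1) * prim m f y]. *)
pose G y := prim k f y - d * (y ^ (k - m) * prim m f y - prim k f y).
have -> : prim k (hardy m f) x = G x.
  apply: prim_antiderivative => //.
  - move=> y y0; have yn0 : y != 0 by rewrite gt_eqF.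
    have dk := is_derive_prim k cf y0.
    have := is_derive1B dk (is_derive1Z d (is_derive1B (is_derive1M
      (is_derive_exprz (k - m) yn0) (is_derive_prim m cf y0)) dk)).
    congr is_derive; rewrite /hardy.
    have -> : y ^ (k - m) * (y ^ m * f y) = y ^ k * f y.
      by rewrite mulrA -expfzDr// subrK.
    have -> : y ^ (k - m - 1) = y ^ k * y ^ (- m - 1).
      by rewrite -expfzDr//; congr exprz; lia.
    by rewrite /d; move: ((k - m)%:~R : R) kmR => q q0; field.
  - by move=> y y0; exact: continuous_hardy.
  - by have [] := hardy_contraction_cpt m cf.
  apply: cvg_near_cst; near=> n.
  have /andP[na _] : (n.+2%:R^-1 : R) < a < n.+2%:R by near: n; exact: near_window.
  have nb : b < n.+2%:R by near: n; exact: near_gtr_natr2.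
  have r0 : 0 < n.+2%:R^-1 :> R by rewrite invr_gt0.
  rewrite /G /tail_end; case: ifP => k0.
    by rewrite !(@prim_eq0 _ _ f n.+2%:R^-1 a b) -?km0 ?k0/= ?(ltW na) ?(ltW nb)//; ring.
  by rewrite !(@prim_eq0 _ _ f n.+2%:R a b) -?km0 ?k0/= ?(ltW na) ?(ltW nb)//; ring.
have E : x ^ (- k - 1) * x ^ (k - m) = x ^ (- m - 1).
  by rewrite -expfzDr ?gt_eqF//; congr exprz; lia.
have -> : (k + m + 1)%:~R = (k - m)%:~R + (2 * m + 1)%:~R :> R.
  by rewrite -intrD; congr intmul; lia.
rewrite /hardy /G -E.
have -> : (2 * k + 1)%:~R = 2 * (k - m)%:~R + (2 * m + 1)%:~R :> R.
  by rewrite -(intrM _ 2) -intrD; congr intmul; lia.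
rewrite /d; move: ((k - m)%:~R : R) kmR => q q0; field.
by rewrite q0.
Unshelve. all: by end_near. Qed.

End HardyCpt.

(** * Smooth bump functions *)

Section SmoothBump.
Context {R : realType}.
Implicit Types (f g : R -> R) (p q : {poly R}) (x y : R).

(** Monomials are compared with one term of the exponential series. The exponent [m] stays general
    in the induction because each Horner step raises it. *)
Lemma horner_expRN_bounded p m :
  exists C, forall y, 0 < y -> `|p.[y]| * y ^+ m * expR (- y) <= C.
Proof.
have mono n y : 0 < y -> y ^+ n * expR (- y) <= n.+1`!%:R.
  move=> y0; rewrite expRN ler_pdivrMr ?expR_gt0//.
  case: n => [|n].
    by rewrite expr0 mul1r ltW// expR_gt1.
  have := @expR_ge1Dxn R y n (ltW y0).
  have f0 : 0 < n.+1`!%:R :> R by rewrite ltr0n fact_gt0.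
  move=> h; have : y ^+ n.+1 <= n.+1`!%:R * expR y.
    by rewrite mulrC -ler_pdivrMr//; apply: le_trans h; rewrite lerDr.
  move/le_trans; apply; rewrite ler_wpM2r ?expR_ge0// ler_nat.
  by rewrite [n.+2`!]factS leq_pmull.
elim/poly_ind: p m => [|p c IH] m.
  by exists 0 => y y0; rewrite horner0 normr0 !mul0r.
have [C HC] := IH m.+1; exists (C + `|c| * m.+1`!%:R) => y y0.
rewrite hornerMXaddC.
apply: (@le_trans _ _ (`|p.[y]| * y ^+ m.+1 * expR (- y) + `|c| * (y ^+ m * expR (- y)))).
  rewrite -mulrA exprS [X in _ <= X](_ : _ = (`|p.[y]| * y + `|c|) * (y ^+ m * expR (- y))); last ring.
  rewrite ler_wpM2r ?mulr_ge0 ?expR_ge0 ?exprn_ge0 ?(ltW y0)//.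
  by apply: le_trans (ler_normD _ _) _; rewrite normrM (gtr0_norm y0).
by rewrite lerD ?HC// ler_wpM2l// mono.
Qed.

(** The classical function exp(-1/x) with a polynomial factor in 1/x, which makes the family stable
    under differentiation: [p] becomes X^2 (p - p'). *)
Definition flat p x : R := if 0 < x then p.[x^-1] * expR (- x^-1) else 0.

(** The square makes the difference quotient at 0 of order [x], so that the derivative there is
    0. *)
Lemma flat_le_sqr p : exists C, forall x, `|flat p x| <= C * x ^+ 2.
Proof.
have [C HC] := horner_expRN_bounded p 2; exists `|C| => x; rewrite /flat.
case: ifPn => x0; last by rewrite normr0 mulr_ge0// sqr_ge0.
have /HC : 0 < x^-1 by rewrite invr_gt0.
rewrite normrM (ger0_norm (expR_ge0 _)).
have -> : `|p.[x^-1]| * x^-1 ^+ 2 * expR (- x^-1) = `|p.[x^-1]| * expR (- x^-1) / x ^+ 2.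
  by rewrite exprVn mulrAC.
rewrite ler_pdivrMr ?exprn_gt0// => /le_trans; apply.
by rewrite ler_wpM2r ?sqr_ge0// ler_norm.
Qed.

Lemma is_derive_flat p x :
  is_derive x 1 (flat p) (flat ('X^2 * (p - p^`())) x).
Proof.
have [x0|x0|->] := ltgtP x 0.
- rewrite {2}/flat ltNge (ltW x0)/=.
  have := is_derive_cst (0 : R) x 1; apply: near_eq_is_derive.
  by near=> y; rewrite /flat ltNge ltW//=; near: y; exact: lt_nbhsl.
- rewrite {2}/flat x0; have xn0 : x != 0 by rewrite gt_eqF.
  apply: (@near_eq_is_derive R R R (fun y => p.[y^-1] * expR (- y^-1))).
    by near=> y; rewrite /flat ifT//; near: y; exact: lt_nbhsr.
  have dV : is_derive x 1 (fun y : R => y^-1) (- x ^- 2).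
    by apply: is_derive_eq; [exact: (@is_deriveV R id)|rewrite /GRing.scale/= mulr1].
  have dp : is_derive x 1 (fun y => p.[y^-1]) (p^`().[x^-1] * - x ^- 2).
    exact: (@is_derive1_comp R (horner p) (fun y => y^-1)).
  have de : is_derive x 1 (fun y => expR (- y^-1)) (expR (- x^-1) * - (- x ^- 2)).
    by apply: (@is_derive1_comp R expR (fun y => - y^-1)); exact: is_deriveN.
  have := is_derive1M dp de; congr is_derive.
  by rewrite hornerM hornerXn hornerD hornerN; field.
- rewrite {2}/flat ltxx; have [C HC] := flat_le_sqr p.
  (* Caratheodory's criterion with slope [flat p z / z], at most [C * |z|] in absolute value; at
     [z = 0] the convention [0^-1 = 0] gives the right slope 0. *)
  apply/is_derive1_caratheodory; exists (fun z => flat p z / z); split.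
  + move=> z; rewrite {2}/flat ltxx !subr0.
    have [->|z0] := eqVneq z 0; first by rewrite mulr0 /flat ltxx.
    by rewrite divfK.
  + rewrite /prop_for /continuous_at invr0 mulr0; apply/cvgrPdist_lt => e e0.
    have C1 : 0 < `|C| + 1 by rewrite ltr_wpDl.
    near=> z; rewrite sub0r normrN.
    have [->|z0] := eqVneq z 0; first by rewrite invr0 mulr0 normr0.
    rewrite normrM normfV ltr_pdivrMr ?normr_gt0//.
    apply: le_lt_trans (HC z) _; rewrite -[z ^+ 2]real_normK ?num_real// expr2 mulrA.
    rewrite ltr_pM2r ?normr_gt0//.
    apply: (@le_lt_trans _ _ ((`|C| + 1) * `|z|)).
      by rewrite ler_wpM2r// (le_trans (ler_norm C))// lerDl.
    rewrite mulrC -ltr_pdivlMr//; near: z.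
    exists (e / (`|C| + 1)); first by rewrite /= divr_gt0.
    by move=> z; rewrite /ball_/= sub0r normrN.
  + by rewrite invr0 mulr0.
Unshelve. all: by end_near. Qed.

(** Closed under differentiation, so that smoothness follows by induction on the order, and closed
    under the linear combinations and dilations of the density argument. *)
Inductive flat_algebra : (R -> R) -> Prop :=
| flat_base p (a b : R) : flat_algebra (fun x => flat p (a * x + b))
| flat_cst (c : R) : flat_algebra (fun=> c)
| flat_add f g : flat_algebra f -> flat_algebra g ->
    flat_algebra (fun x => f x + g x)
| flat_mul f g : flat_algebra f -> flat_algebra g ->
    flat_algebra (fun x => f x * g x).

Lemma flat_algebra_derive f : flat_algebra f ->
  exists2 g, flat_algebra g & forall x, is_derive x 1 f (g x).
Proof.
elim=> {f} [p a b|c|f g _ [f' sf df] _ [g' sg dg]|f g sf0 [f' sf df] sg0 [g' sg dg]].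
- exists (fun x => flat ('X^2 * (p - p^`())) (a * x + b) * a).
    exact: (flat_mul (flat_base _ _ _) (flat_cst _)).
  move=> x; apply: (@is_derive1_comp R (flat p) (fun y => a * y + b)).
    exact: is_derive_flat.
  have := is_deriveD (is_derive1Z a (is_derive_id x 1)) (is_derive_cst b x 1).
  by rewrite mulr1 addr0.
- by exists (fun=> 0) => [|x]; [exact: flat_cst|exact: (is_derive_cst c x 1)].
- exists (fun x => f' x + g' x); first exact: flat_add.
  by move=> x; exact: is_deriveD.
- exists (fun x => f' x * g x + f x * g' x).
    by apply: flat_add; apply: flat_mul.
  by move=> x; exact: is_derive1M.
Qed.

Lemma flat_algebra_smooth f : flat_algebra f -> smooth f.
Proof.
move=> sf n x; suff {x} : flat_algebra (derive1n n f).
  by move=> /flat_algebra_derive[g _ /(_ x)[]].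
elim: n => [//|n /flat_algebra_derive[g sg dg]].
rewrite derive1nS (_ : _^`()%classic = g)//.
by apply/funext => x; rewrite derive1E; case: (dg x).
Qed.

Lemma flat_algebra_dilate f (c : R) : flat_algebra f ->
  flat_algebra (fun x => f (c * x)).
Proof.
elim=> {f} [p a b|d|f g _ sf _ sg|f g _ sf _ sg].
- by have := flat_base p (a * c) b; under eq_fun do rewrite -mulrA.
- exact: flat_cst.
- exact: (flat_add sf sg).
- exact: (flat_mul sf sg).
Qed.

Lemma smooth_continuous f : smooth f -> continuous f.
Proof. by move=> sf x; apply/differentiable_continuous/derivable1_diffP; exact: (sf 0). Qed.

(** Inside []c, d[] both factors tend to 1 with [n], since exp(-1/(n t)) does for t > 0; outside,
    one factor is 0. The arguments are spelled [a * x + b] to fit [flat_base]. *)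
Definition flat_bump (c d : R) n x : R :=
  flat 1 (n%:R * x + - (n%:R * c)) * flat 1 (- n%:R * x + n%:R * d).

Lemma flat_bump_algebra c d n : flat_algebra (flat_bump c d n).
Proof. exact: (flat_mul (flat_base _ _ _) (flat_base _ _ _)). Qed.

Lemma flat1_itv x : 0 <= flat 1 x <= 1.
Proof.
rewrite /flat; case: ifP => [x0|_]; last by rewrite lexx ler01.
by rewrite hornerC mul1r expR_ge0/= expR_le1 oppr_le0 invr_ge0 ltW.
Qed.

Lemma flat_bump_indic c d n x : 0 <= flat_bump c d n x <= \1_`]c, d[%classic x.
Proof.
rewrite /flat_bump (_ : n%:R * x + - (n%:R * c) = n%:R * (x - c)); last ring.
rewrite (_ : - n%:R * x + n%:R * d = n%:R * (d - x)); last ring.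
have /andP[a0 a1] := flat1_itv (n%:R * (x - c)).
have /andP[b0 b1] := flat1_itv (n%:R * (d - x)).
have flat0 t : t <= 0 -> flat 1 (n%:R * t) = 0.
  by move=> t0; rewrite /flat ltNge mulr_ge0_le0.
rewrite mulr_ge0//= indicE; have [_|] := boolP (x \in _).
  by rewrite mulr_ile1.
rewrite notin_setE/= in_itv/= => /negP; rewrite negb_and -!leNgt => /orP[xc|dx].
  by rewrite flat0 ?subr_le0// mul0r.
by rewrite (flat0 (d - x)) ?subr_le0// mulr0.
Qed.

Lemma cvg_flat_bump c d x : flat_bump c d n x @[n --> \oo] --> (\1_`]c, d[%classic x : R).
Proof.
have [xcd|] := boolP (x \in `]c, d[%classic); last first.
  move=> xcd; apply: cvg_near_cst; apply: nearW => n.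
  have := flat_bump_indic c d n x; rewrite indicE (negbTE xcd) => /andP[h1 h2].
  by apply/eqP; rewrite eq_le h1 h2.
have := xcd; rewrite inE/= in_itv/= => /andP[cx xd].
have cvg_flat (t : R) : 0 < t -> flat 1 (n%:R * t) @[n --> \oo] --> (1 : R).
  move=> t0; have : expR (- (n%:R * t)^-1) @[n --> \oo] --> expR (- 0 : R).
    apply: (@cvg_comp _ _ _ _ expR _ _ _ _ (@continuous_expR R _)).
    apply: cvgN; have -> : (fun n => (n%:R * t)^-1) = (fun n => t^-1 * (n%:R^-1 : R)).
      by apply/funext => n; rewrite invfM mulrC.
    rewrite -(mulr0 t^-1); apply: cvgMr.
    apply/cvgrPdist_lt => e e0; near=> n.
    have en : e^-1 < n%:R by near: n; exact: nbhs_infty_gtr.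
    have n0 : 0 < n%:R :> R by rewrite (lt_trans _ en)// invr_gt0.
    by rewrite sub0r normrN ger0_norm ?invr_ge0 ?(ltW n0)// invf_plt.
  rewrite oppr0 expR0; apply: cvg_trans; apply: near_eq_cvg; near=> n.
  have n0 : (0 < n)%N by near: n; exact: nbhs_infty_gt.
  by rewrite /flat mulr_gt0 ?ltr0n// hornerC mul1r.
rewrite indicE xcd -[1%:R]mul1r.
rewrite -subr_gt0 in cx; rewrite -subr_gt0 in xd.
have -> : flat_bump c d ^~ x = (fun n => flat 1 (n%:R * (x - c)) * flat 1 (n%:R * (d - x))).
  by apply/funext => n; rewrite /flat_bump; congr (flat _ _ * flat _ _); ring.
exact: (cvgM (cvg_flat _ cx) (cvg_flat _ xd)).
Unshelve. all: by end_near. Qed.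

End SmoothBump.

(** * Density of test functions with vanishing moments *)

Section Density.
Context {R : realType}.
Local Notation mu := (@lebesgue_measure R).
Local Notation H := (@half_line R).
Implicit Types (A B : set R) (f g h : R -> R) (k : int) (ks : seq int) (x y : R).

(** Membership in [flat_algebra] replaces smoothness, which it implies, because it is preserved by
    every operation of the density proof. *)
Definition test_fun ks f :=
  [/\ flat_algebra f, (exists a b, 0 < a /\ forall x, f x != 0 -> a <= x <= b)
    & forall k, k \in ks -> moment k f = 0].

Lemma test_fun_cpt ks f : test_fun ks f -> continuous_cpt f.
Proof. by case=> /flat_algebra_smooth /smooth_continuous. Qed.

Lemma moment_lin k c f g : continuous_cpt f -> continuous_cpt g ->
  moment k (fun x => c * f x + g x) = c * moment k f + moment k g.
Proof.
move=> cf cg; rewrite -[X in _ = _ + X]mul1r -Rintegral_lin; last 3 first.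
- exact: measurable_half_line.
- exact: integrable_cpt.
- exact: integrable_cpt.
by apply: eq_Rintegral => y _; ring.
Qed.

Lemma test_fun_lin ks c f g : test_fun ks f -> test_fun ks g ->
  test_fun ks (fun x => c * f x + g x).
Proof.
move=> Tf Tg; have cf := test_fun_cpt Tf; have cg := test_fun_cpt Tg.
case: Tf Tg => sf [a [b [a0 fab]]] mf [sg [a' [b' [a'0 gab]]] mg]; split.
- by apply: flat_add => //; apply: flat_mul => //; exact: flat_cst.
- exists (Num.min a a'), (Num.max b b'); split; first by rewrite lt_min a0.
  move=> x; have [->|/fab/andP[ax xb] _] := eqVneq (f x) 0.
    by rewrite mulr0 add0r => /gab/andP[ax xb]; rewrite ge_min le_max ax xb !orbT.
  by rewrite ge_min le_max ax xb.
- by move=> k kks; rewrite moment_lin// mf// mg// mulr0 addr0.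
Qed.

Definition in_closure ks f :=
  rL2 H f /\ forall e, 0 < e -> exists2 g, test_fun ks g &
    nrm H (fun x => f x - g x) < e.

Lemma rL2_test_fun ks f : test_fun ks f -> rL2 H f.
Proof. by move/test_fun_cpt/rL2_cpt. Qed.

Lemma test_fun_closure ks f : test_fun ks f -> in_closure ks f.
Proof.
move=> Tf; split; first exact: rL2_test_fun Tf.
move=> e e0; exists f => //; rewrite (@eq_nrm _ _ _ (fun=> 0 * 0)); last first.
  by move=> x _; rewrite subrr mul0r.
rewrite /nrm (_ : Rintegral _ _ _ = 0) ?sqrtr0//.
rewrite /Rintegral (@eq_integral _ _ _ _ _ (cst 0%E)) ?integral0//.
by move=> x _; rewrite mul0r expr0n.
Qed.

Lemma in_closure_lim ks f : rL2 H f ->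
  (forall e, 0 < e -> exists2 g, in_closure ks g & nrm H (fun x => f x - g x) < e) ->
  in_closure ks f.
Proof.
move=> Lf Hf; split=> // e e0; have e2 : 0 < e / 2 by rewrite divr_gt0.
have [g [Lg /(_ _ e2)[h Th gh] fg]] := Hf _ e2; exists h => //.
have Lh := rL2_test_fun Th; have mH := @measurable_half_line R.
rewrite (@eq_nrm _ _ _ (fun x => (f x - g x) + (g x - h x))); last first.
  by move=> x _; rewrite addrA subrK.
apply: (le_lt_trans (ler_nrmD mH (rL2B mH Lf Lg) (rL2B mH Lg Lh))).
by rewrite (splitr e) ltrD.
Qed.

Lemma in_closure_lin ks c f g : in_closure ks f -> in_closure ks g ->
  in_closure ks (fun x => c * f x + g x).
Proof.
have mH := @measurable_half_line R.
case=> Lf Hf [Lg Hg]; split; first exact: rL2_lin.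
move=> e e0; have c1 : 0 < `|c| + 1 by rewrite ltr_wpDl.
have e1 : 0 < e / 2 / (`|c| + 1) by rewrite !divr_gt0.
have e2 : 0 < e / 2 by rewrite divr_gt0.
have [f' Tf' ff'] := Hf _ e1; have [g' Tg' gg'] := Hg _ e2.
have Lf' := rL2_test_fun Tf'; have Lg' := rL2_test_fun Tg'.
exists (fun x => c * f' x + g' x); first exact: test_fun_lin.
rewrite (@eq_nrm _ _ _ (fun x => c * (f x - f' x) + (g x - g' x))); last first.
  by move=> x _; ring.
apply: (le_lt_trans (ler_nrmD mH (rL2Z c mH (rL2B mH Lf Lf')) (rL2B mH Lg Lg'))).
rewrite nrmZ//; last exact: rL2B.
rewrite (splitr e) ler_ltD//; move: ff'; rewrite ltr_pdivlMr// mulrC => /ltW; apply: le_trans.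
by rewrite ler_wpM2r ?nrm_ge0// lerDl.
Qed.

Lemma in_closure_eq ks f g : {in H, f =1 g} -> in_closure ks f -> in_closure ks g.
Proof.
move=> fg [Lf Hf]; split; first exact: rL2_eq fg Lf.
move=> e /Hf[h Th fh]; exists h => //.
by rewrite -(@eq_nrm _ _ (fun x => f x - h x))// => x /fg ->.
Qed.

Lemma in_closure_dom ks (fn : nat -> R -> R) f h : rL2 H h ->
  (forall n, in_closure ks (fn n)) -> measurable_fun H f ->
  (forall n x, H x -> `|fn n x| <= `|h x|) ->
  (forall x, H x -> fn n x @[n --> \oo] --> f x) ->
  in_closure ks f.
Proof.
move=> Lh Cf mf fnh fnf; have mH := @measurable_half_line R.
have fh x : H x -> `|f x| <= `|h x|.
  move=> Hx; have nf : `|fn n x| @[n --> \oo] --> `|f x| by exact: cvg_norm (fnf x Hx).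
  have <- := cvg_lim (@Rhausdorff R) nf.
  by apply: limr_le; [apply/cvg_ex; exists (`|f x|)|apply: nearW => n; exact: fnh].
have Lf : rL2 H f := (rL2_le mH mf Lh fh).1.
apply: in_closure_lim => // e e0.
have Lfn n : rL2 H (fn n) by case: (Cf n).
have : nrm H (fun x => f x - fn n x) ^+ 2 @[n --> \oo] --> (0 : R).
  under eq_fun do rewrite sqr_nrm.
  have -> : (0 : R) = fine (\int[mu]_(x in H) (0 : \bar R))%E by rewrite integral0.
  apply: fine_cvg; rewrite fineK ?integral0//.
  rewrite -[X in _ --> X](@integral0 _ (measurableTypeR R) R mu H).
  have mH' : @measurable _ (measurableTypeR R) H := mH.
  (* Both [f] and [fn n] are bounded by [|h|], hence the squared difference by [4 * h ^ 2]. *)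
  apply: (@dominated_cvg _ (measurableTypeR R) R mu H mH' _ _ (fun x => (4 * h x ^+ 2)%:E)) => //.
  - move=> n; apply/measurable_EFinP; apply: measurable_funX; apply: measurable_funB => //.
    by case: (Lfn n).
  - move=> x Hx; apply/cvg_EFin; first exact: nearW.
    have -> : (0 : R) = (f x - f x) ^+ 2 by rewrite subrr expr0n.
    apply: (@cvg_comp _ _ _ _ (fun y : R => y ^+ 2)); last exact: exprn_continuous.
    by apply: cvgB; [exact: cvg_cst|exact: fnf].
  - have [_ h2] := Lh; have := integrableZl mH' 4 h2.
    by apply: eq_integrable => // x _; rewrite /= EFinM.
  - move=> n x Hx /=; rewrite lee_fin ger0_norm ?sqr_ge0//.
    have -> : 4 * h x ^+ 2 = (2 * `|h x|) ^+ 2 by rewrite exprMn real_normK ?num_real//; ring.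
    rewrite -[leLHS]real_normK ?num_real// lerXn2r ?nnegrE ?mulr_ge0//.
    apply: le_trans (ler_normB _ _) _; rewrite mulrDl mul1r lerD ?fh ?fnh//.
move=> /cvgrPdist_lt /(_ (e ^+ 2)); rewrite exprn_gt0// => /(_ isT) [N _ /(_ N (leqnn N))].
rewrite /= sub0r normrN ger0_norm ?sqr_ge0// => fN; exists (fn N) => //.
by move: fN; rewrite ltr_pXn2r ?nnegrE ?nrm_ge0// ltW.
Qed.

(** * From intervals to measurable sets, simple functions and all of L2 *)

Definition ind A x : R := \1_A x.

Lemma indE A x : ind A x = (x \in A)%:R.
Proof. by rewrite /ind indicE. Qed.

Lemma rL2_indic_itv c d : 0 < c -> rL2 H (ind `]c, d[).
Proof.
move=> c0; split; first exact: measurable_indic.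
have := @integrable_indic_itv R c d false true.
move/(@integrableS _ (measurableTypeR R) R mu setT H) => /(_ _ _ _)/wrap[] //.
  exact: measurable_half_line.
apply: eq_integrable; first exact: measurable_half_line.
by move=> x _ /=; rewrite /ind !indicE; case: (_ \in _); rewrite ?expr1n ?expr0n.
Qed.

Lemma closure_indic_itv c d : 0 < c -> in_closure [::] (ind `]c, d[).
Proof.
move=> c0; apply: (@in_closure_dom [::] (flat_bump c d) (ind `]c, d[) (ind `]c, d[) (rL2_indic_itv d c0)).
- move=> n; apply: test_fun_closure; split=> //; first exact: flat_bump_algebra.
  exists c, d; split=> // x; have /andP[b0] := flat_bump_indic c d n x.
  rewrite indicE; have [|_] := boolP (x \in _).
    by rewrite inE/= in_itv/= => /andP[cx xd] _ _; rewrite !ltW.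
  by move=> b1; rewrite (@le_anti _ _ (flat_bump c d n x) 0) ?eqxx// b0 andbT.
- exact: measurable_indic.
- move=> n x _; have /andP[b0 b1] := flat_bump_indic c d n x.
  by rewrite !ger0_norm// /ind (le_trans b0).
- by move=> x _; exact: cvg_flat_bump.
Qed.

(** Dynkin's pi-lambda argument on open rays. Intersecting with a fixed window keeps every
    indicator, and every partial sum over a disjoint family, below a single L2 function. *)
Lemma closure_indic r X S : 0 < r -> @measurable _ (measurableTypeR R) S ->
  in_closure [::] (ind (S `&` `]r, X[)).
Proof.
move=> r0; have mB : measurable (`]r, X[%classic : set R) by exact: measurable_itv.
have LB := rL2_indic_itv X r0.
have mI (S' : set R) : measurable S' -> measurable_fun H (ind (S' `&` `]r, X[)).
  by move=> mS; apply: measurable_indic; exact: measurableI.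
have CB : in_closure [::] (ind `]r, X[) by exact: closure_indic_itv.
rewrite [X in X S](RGenOInfty.measurableE R).
pose P (S' : set (measurableTypeR R)) := in_closure [::] (ind (S' `&` `]r, X[)).
move: S; suff : forall S', <<s @RGenOInfty.G R >> S' -> P S' by [].
apply: (@dynkin_induction _ (measurableTypeR R) (@RGenOInfty.G R) P).
- exact: RGenOInfty.measurableE.
- move=> _ _ [x ->] [y ->]; exists (Num.max x y); rewrite eqEsubset; split=> z/=; rewrite !in_itv/= !andbT gt_max.
    by move=> [-> ->].
  by move=> /andP[].
- by rewrite /P setTI.
- move=> _ [x ->]; rewrite /P; have rx : 0 < Num.max x r by rewrite lt_max r0 orbT.
  have := closure_indic_itv X rx; congr (in_closure _ (ind _)).
  rewrite eqEsubset; split=> z/=; rewrite !in_itv/= !andbT gt_max.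
    by move=> /andP[/andP[-> ->] ->].
  by move=> [-> /andP[-> ->]].
- move=> S' mS C; rewrite /P; have := in_closure_lin (-1) C CB; apply: in_closure_eq => x _.
  rewrite !indE !in_setI in_setC; do 2 case: (_ \in _) => /=; ring.
- move=> F mF tF CF.
  (* By disjointness these partial sums take only the values 0 and 1. *)
  pose fn n x := \sum_(i < n) ind (F i `&` `]r, X[) x.
  have fnE n x j : F j x -> `]r, X[%classic x -> fn n x = (j < n)%:R.
    move=> Fj Bx; have indF i : ind (F i `&` `]r, X[) x = (i == j)%:R.
      rewrite indE; congr (nat_of_bool _)%:R; apply/idP/eqP => [|->]; last by rewrite inE.
      by rewrite inE => -[Fi _]; apply: tF => //; exists x.
    rewrite /fn; elim: n => [|n IH]; first by rewrite big_ord0.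
    rewrite big_ord_recr/= IH indF -natrD; congr (_%:R).
    by rewrite ltnS (leq_eqVlt j) eq_sym; case: ltngtP.
  have fn0 n x : ~ (exists j, F j x /\ `]r, X[%classic x) -> fn n x = 0.
    move=> nj; rewrite /fn big1// => i _; rewrite indE memNset//.
    by move=> [Fi Bx]; apply: nj; exists i.
  apply: (@in_closure_dom [::] fn (ind ((\bigcup_k F k) `&` `]r, X[)) (ind `]r, X[) LB).
  + elim=> [|n IH].
      (* The zero function, obtained as [- g + g]. *)
      have := in_closure_lin (-1) CB CB; apply: in_closure_eq => x _.
      by rewrite /fn big_ord0; ring.
    have := in_closure_lin 1 IH (CF n); apply: in_closure_eq => x _.
    by rewrite /fn big_ord_recr/= mul1r.
  + by apply: mI; exact: bigcupT_measurable.
  + move=> n x _; have [[j [Fj Bx]]|nj] := pselect (exists j, F j x /\ `]r, X[%classic x).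
      by rewrite (fnE n x j)// indE mem_set// normr1 ger0_norm// lern1 leq_b1.
    by rewrite fn0// normr0.
  + move=> x _; have [[j [Fj Bx]]|nj] := pselect (exists j, F j x /\ `]r, X[%classic x).
      apply: cvg_near_cst; near=> n; rewrite (fnE n x j)// indE mem_set; last first.
        by split=> //; exists j.
      by rewrite (_ : (j < n)%N)//; near: n; exact: nbhs_infty_gt.
    apply: cvg_near_cst; apply: nearW => n; rewrite fn0// indE memNset//.
    by move=> [[i _ Fi] Bx]; apply: nj; exists i.
Unshelve. all: by end_near. Qed.

(** Simple functions increasing to [f], cut off to windows that exhaust the half line, converge
    pointwise and stay below [f]. *)
Lemma closure_ge0 f : rL2 H f -> (forall x, 0 <= f x) -> in_closure [::] f.
Proof.
move=> Lf f0; have [mf _] := Lf.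
have mH' : @measurable _ (measurableTypeR R) H := measurable_half_line.
have mfE : @measurable_fun _ _ (measurableTypeR R) _ H (EFin \o f) by exact/measurable_EFinP.
have fE0 x : H x -> (0 <= (EFin \o f) x)%E by move=> _; rewrite lee_fin.
pose g := nnsfun_approx mH' mfE.
have gf n x : H x -> g n x <= f x.
  move=> Hx; rewrite -lee_fin /g nnsfun_approxE; exact: le_approx.
have cg x : H x -> g n x @[n --> \oo] --> f x.
  move=> Hx; have := cvg_nnsfun_approx mH' mfE fE0 Hx.
  by move/fine_cvgP => [].
pose B n := `]n.+2%:R^-1, n.+2%:R[%classic : set R.
apply: (@in_closure_dom [::] (fun n x => g n x * ind (B n) x) f f Lf) => //.
- move=> n; pose s := fset_set (g n @` setT).
  apply: (@in_closure_eq _ (fun x => \sum_(i < #|`s|) s`_i * ind (g n @^-1` [set s`_i] `&` B n) x)).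
    move=> x _; rewrite [g n x]fimfunEord mulr_suml; apply: eq_bigr => i _.
    rewrite -mulrA; congr (_ * _); rewrite !indE indicE in_setI.
    by case: (_ \in _); case: (_ \in _); rewrite ?mulr1 ?mulr0 ?mul0r.
  have r0 : 0 < n.+2%:R^-1 :> R by rewrite invr_gt0.
  elim: #|`s| => [|m IH].
    have C := closure_indic n.+2%:R r0 (measurableT : @measurable _ (measurableTypeR R) _).
    have := in_closure_lin (-1) C C; apply: in_closure_eq => x _.
    by rewrite big_ord0; ring.
  have C := @closure_indic n.+2%:R^-1 n.+2%:R (g n @^-1` [set s`_m]) r0.
  have mgn : @measurable _ (measurableTypeR R) (g n @^-1` [set s`_m]).
    by exact: measurable_sfunP.
  apply: (in_closure_eq _ (in_closure_lin s`_m (C mgn) IH)) => x _.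
  by rewrite big_ord_recr/= addrC.
- move=> n x Hx; rewrite !ger0_norm ?mulr_ge0// ?indE//.
  by case: (_ \in _); rewrite ?mulr1 ?mulr0// gf.
- move=> x Hx; have x0 : 0 < x by move: Hx; rewrite /half_line /= in_itv/= andbT.
  have := cg x Hx; apply: cvg_trans; apply: near_eq_cvg.
  apply: filterS (near_window x0) => n /andP[nx xn].
  by rewrite indE mem_set ?mulr1// /B /= in_itv/= nx.
Qed.

Lemma closure_rL2 f : rL2 H f -> in_closure [::] f.
Proof.
move=> Lf; have mf := Lf.1.
have C h : measurable_fun H h -> (forall x, 0 <= h x) -> (forall x, h x <= `|f x|) ->
    in_closure [::] h.
  move=> mh h0 hf; apply: closure_ge0 => //.
  apply: (rL2_le (@measurable_half_line R) mh Lf _).1 => x _.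
  by rewrite ger0_norm.
have C1 : in_closure [::] (fun x => Num.max (f x) 0).
  apply: C => [|x|x]; first exact: measurable_maxr.
    by rewrite le_max lexx orbT.
  by rewrite ge_max ler_norm normr_ge0.
have C2 : in_closure [::] (fun x => Num.max (- f x) 0).
  apply: C => [|x|x]; first by apply: measurable_maxr => //; exact: measurable_funN.
    by rewrite le_max lexx orbT.
  by rewrite ge_max -normrN ler_norm normr_ge0.
have := in_closure_lin (-1) C2 C1; apply: in_closure_eq => x _.
by case: (leP (f x) 0) => f0; case: (leP (- f x) 0) => f1; lra.
Qed.

(** * Dilations and the removal of moments *)

Definition dilate (t : R) f x := f (t^-1 * x).

Lemma dilate_supp t f a b : 0 < t -> (forall x, f x != 0 -> a <= x <= b) ->
  forall x, dilate t f x != 0 -> t * a <= x <= t * b.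
Proof.
move=> t0 fab x /fab; rewrite mulrC ler_pdivlMr// ler_pdivrMr//.
by rewrite ![_ * t]mulrC.
Qed.

Lemma dilate_cpt t f : 0 < t -> continuous_cpt f -> continuous_cpt (dilate t f).
Proof.
move=> t0 [cf [a [b [a0 fab]]]]; split.
  move=> x; apply: (@continuous_comp _ _ _ (fun y => t^-1 * y) f); last exact: cf.
  exact: mulrl_continuous.
exists (t * a), (t * b); split; first by rewrite mulr_gt0.
exact: dilate_supp.
Qed.

(** Change of variables by uniqueness of antiderivatives: [t ^ (k+1) * prim k f (y / t)]
    differentiates to the right integrand and vanishes at the right end, so it is the primitive of
    the dilate. Evaluating beyond the supports gives the moments. *)
Lemma moment_dilate k f t : 0 < t -> continuous_cpt f ->
  moment k (dilate t f) = t ^ (k + 1) * moment k f.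
Proof.
move=> t0 cf; have cd := dilate_cpt t0 cf; have [cf' [a [b [a0 fab]]]] := cf.
have tV0 : 0 < t^-1 by rewrite invr_gt0.
have tn0 : t != 0 by rewrite gt_eqF.
pose G y := t ^ (k + 1) * prim k f (t^-1 * y).
have dab := dilate_supp t0 fab.
have E y : 0 < y -> prim k (dilate t f) y = G y.
  move=> y0; apply: prim_antiderivative => //.
  - move=> z z0; have tz0 : 0 < t^-1 * z by rewrite mulr_gt0.
    have d1 : is_derive z 1 (fun z => t^-1 * z) (t^-1).
      by have := is_derive1Z (t^-1) (is_derive_id z 1); rewrite mulr1.
    have := is_derive1Z (t ^ (k + 1)) (@is_derive1_comp R (prim k f) _ _ _ _ (is_derive_prim k cf tz0) d1).
    congr is_derive; rewrite exprzMl ?unitfE ?invr_eq0// ?gt_eqF//; last first.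
    rewrite /dilate exprz_inv expfzDr// expr1z.
    have E : t ^ k * t ^ (- k) = 1 by rewrite -expfzDr// subrr expr0z.
    transitivity ((t ^ k * t ^ (- k)) * (t * t^-1) * (z ^ k * f (t^-1 * z))); first ring.
    by rewrite E mulfV// !mul1r.
  - by move=> z _; exact: cd.1.
  - exact: rL2_cpt.
  apply: cvg_near_cst; near=> n.
  have /andP[na _] : (n.+2%:R^-1 : R) < t * a < n.+2%:R by near: n; apply: near_window; rewrite mulr_gt0.
  have nb : t * b < n.+2%:R by near: n; exact: near_gtr_natr2.
  rewrite /G (@prim_eq0 _ k f _ a b) ?mulr0// /tail_end; first by case: ifP => _; rewrite mulr_gt0// invr_gt0.
  case: (0 <= k); last by rewrite ler_pdivlMl// ltW.
  by rewrite ler_pdivrMl// ltW.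
(* A point where both primitives have reached their constant values, plus or minus the moment. *)
have [y [y0 yk yk']] : exists y, [/\ 0 < y, if 0 <= k then t * b < y else y < t * a &
    if 0 <= k then b < t^-1 * y else t^-1 * y < a].
  case: (0 <= k).
    exists (Num.max (t * b) 0 + 1); split.
    - by rewrite ltr_wpDl// le_max lexx orbT.
    - by rewrite (@le_lt_trans _ _ (Num.max (t * b) 0)) ?ltrDl// le_max lexx.
    - by rewrite ltr_pdivlMl// (@le_lt_trans _ _ (Num.max (t * b) 0)) ?ltrDl// le_max lexx.
  have ta : 0 < t * a by rewrite mulr_gt0.
  exists (t * a / 2); split; first by rewrite divr_gt0.
    by rewrite ltr_pdivrMr// ltr_pMr// ltr1n.
  by rewrite ltr_pdivrMl// ltr_pdivrMr// ltr_pMr// ltr1n.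
have := E y y0; rewrite /G (prim_cst y0 dab)// (@prim_cst _ k f _ a b)//; last by rewrite mulr_gt0.
rewrite mulrCA; case: (0 <= k); first by rewrite !mul1r.
by rewrite !mulN1r => /oppr_inj.
Unshelve. all: by end_near. Qed.

(** The case [k = 0] of [moment_dilate] for [f * f]. *)
Lemma sqr_nrm_dilate f t : 0 < t -> continuous_cpt f ->
  nrm H (dilate t f) ^+ 2 = t * nrm H f ^+ 2.
Proof.
move=> t0 cf; have [cf' [a [b [a0 fab]]]] := cf.
have cff : continuous_cpt (fun x => f x * f x).
  split=> [x|]; first by apply: continuousM; exact: cf'.
  by exists a, b; split=> // x; rewrite mulf_eq0 orbb => /fab.
have := moment_dilate 0 t0 cff; rewrite add0r expr1z !sqr_nrm.
rewrite /moment /dilate => E.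
transitivity (\int[mu]_(y in H) (y ^ 0 * (f (t^-1 * y) * f (t^-1 * y)))).
  by apply: eq_Rintegral => x _; rewrite expr0z mul1r.
rewrite E; congr (_ * _); apply: eq_Rintegral => x _; rewrite expr0z mul1r//.
Qed.

Lemma test_fun_dilate ks f t : 0 < t -> test_fun ks f -> test_fun ks (dilate t f).
Proof.
move=> t0 Tf; have cf := test_fun_cpt Tf; case: Tf => sf [a [b [a0 fab]]] mf; split.
- exact: flat_algebra_dilate.
- by exists (t * a), (t * b); split; [rewrite mulr_gt0|exact: dilate_supp].
- by move=> k /mf; rewrite moment_dilate// => ->; rewrite mulr0.
Qed.

(* The functional [moment k] scales like [t ^ (k + 1)] under dilation whereas
   the L2 norm scales like [t ^ (1 / 2)]: subtracting a suitable dilate kills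
   the moment at an arbitrarily small cost in norm. *)
Lemma closure_moment k ks f : test_fun ks f -> in_closure (k :: ks) f.
Proof.
move=> Tf; have Lf := rL2_test_fun Tf; split=> // e e0; have cf := test_fun_cpt Tf.
pose d := e ^+ 2 / (nrm H f ^+ 2 + 1).
have N1 : 0 < nrm H f ^+ 2 + 1 by rewrite ltr_wpDl ?sqr_ge0.
have d0 : 0 < d by rewrite divr_gt0// exprn_gt0.
(* The correction [c * dilate t f] below has squared norm [t ^ (-2k-1) * nrm f ^ 2]. The exponent is
   odd, hence nonzero: [t] is taken large for [k >= 0] and small for [k < 0]. *)
have [t t0 td] : exists2 t : R, 0 < t & t ^ (- 2 * k - 1) <= d.
  pose u := Num.min d 1; have u0 : 0 < u by rewrite lt_min d0 ltr01.
  have uX n : u ^+ n.+1 <= d.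
    apply: (@le_trans _ _ u); last by rewrite ge_min lexx.
    by rewrite exprS ger_pMr// exprn_ile1 ?(ltW u0)// ge_min lexx orbT.
  have [k0|k0] := leP 0 k.
    exists u^-1; first by rewrite invr_gt0.
    rewrite exprz_inv (_ : - (-2 * k - 1) = (absz (2 * k)).+1); last lia.
    exact: uX.
  exists u => //; rewrite (_ : -2 * k - 1 = (absz (- (2 * k + 2))).+1); last lia.
  exact: uX.
have tn0 : t != 0 by rewrite gt_eqF.
(* Chosen so that [c * t ^ (k+1) = 1]: the dilate then has the [k]-th moment of [f]. The moments in
   [ks] remain 0. *)
pose c := t ^ (- k - 1); have Td := test_fun_dilate t0 Tf.
exists (fun x => - c * dilate t f x + f x).
  have [sg supp mg] := test_fun_lin (- c) Td Tf; split=> // j.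
  rewrite inE => /predU1P[->|/mg//].
  rewrite (moment_lin k (- c) (test_fun_cpt Td) cf) moment_dilate// mulrA mulNr /c -expfzDr//.
  by rewrite (_ : - k - 1 + (k + 1) = 0) ?expr0z ?mulN1r ?addNr//; ring.
rewrite (@eq_nrm _ _ _ (fun x => c * dilate t f x)); last first.
  by move=> x _; ring.
have mH := @measurable_half_line R.
rewrite nrmZ//; last exact: rL2_test_fun Td.
rewrite -(@ltr_pXn2r _ 2)// ?nnegrE ?mulr_ge0 ?nrm_ge0 ?(ltW e0)//.
rewrite exprMn sqr_nrm_dilate// real_normK ?num_real// mulrA.
have -> : c ^+ 2 * t = t ^ (- 2 * k - 1).
  rewrite -{1}(expr1z t) /c expr2 -!expfzDr//; congr exprz; lia.
apply: (@le_lt_trans _ _ (d * nrm H f ^+ 2)); first by rewrite ler_wpM2r ?sqr_ge0.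
by rewrite /d mulrAC ltr_pdivrMr// ltr_pM2l ?exprn_gt0// ltrDl.
Qed.

Lemma test_fun_dense ks f : rL2 H f -> in_closure ks f.
Proof.
elim: ks f => [|k ks IH] f Lf; first exact: closure_rL2.
apply: in_closure_lim => // e /((IH f Lf).2)[g Tg fg].
by exists g => //; exact: closure_moment.
Qed.

End Density.

(** * Extension to L2 *)

Section Extension.
Context {R : realType}.
Local Notation mu := (@lebesgue_measure R).
Local Notation H := (@half_line R).
Local Notation mH := (@measurable_half_line R).
Implicit Types (A B : set R) (f g h : R -> R) (k : int) (x y : R).
Implicit Types (S T : (R -> R) -> R -> R).

(** [prim k f] is the pointwise limit of the continuous functions [prim k (g n)], with [g n] test
    functions tending to [f] in L2. *)
Lemma measurable_prim k f : rL2 H f -> measurable_fun H (prim k f).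
Proof.
move=> Lf.
have gP n : exists g, test_fun [::] g /\ nrm H (fun x => f x - g x) < n.+2%:R^-1.
  have n0 : 0 < n.+2%:R^-1 :> R by rewrite invr_gt0.
  by have [_ /(_ _ n0)[g Tg fg]] := test_fun_dense [::] Lf; exists g.
pose g n := sval (cid (gP n)).
have gT n : test_fun [::] (g n) by have [] := svalP (cid (gP n)).
have fg n : nrm H (fun x => f x - g n x) < n.+2%:R^-1 by have [] := svalP (cid (gP n)).
apply: (@measurable_fun_cvg _ _ R H (fun n => prim k (g n))) => [n|x Hx].
  apply: measurable_continuous => x x0.
  exact: is_derive_continuous (is_derive_prim k (test_fun_cpt (gT n)) x0).
have x0 : 0 < x by move: Hx; rewrite /half_line /= in_itv/= andbT.
pose N := nrm (tail k x) (fun y => y ^ k).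
have N1 : 0 < N + 1 by rewrite ltr_wpDl ?nrm_ge0.
have d n : `|prim k f x - prim k (g n) x| <= (N + 1) * n.+2%:R^-1.
  have Lg := rL2_test_fun (gT n); have Lfg := rL2B mH Lf Lg.
  have -> : prim k f x - prim k (g n) x = prim k (fun y => f y - g n y) x.
    have := prim_lin k (-1) x0 Lg Lf; rewrite mulN1r addrC => <-.
    by congr (prim k _ x); apply/funext => y; rewrite mulN1r addrC.
  apply: (le_trans (ler_norm_prim k x0 Lfg)).
  by rewrite ler_pM ?nrm_ge0// ?lerDl// ltW.
have : (N + 1) * n.+2%:R^-1 @[n --> \oo] --> (N + 1) * 0.
  by apply: cvgMr; exact: cvg_invr_natr2.
rewrite mulr0 => /cvgrPdist_lt c.
apply/cvgrPdist_lt => e /c; apply: filterS => n.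
rewrite sub0r normrN ger0_norm ?mulr_ge0 ?invr_ge0 ?(ltW N1)//.
exact: le_lt_trans (d n).
Qed.

Lemma hardy_contraction k f : rL2 H f ->
  rL2 H (hardy k f) /\ nrm H (hardy k f) <= nrm H f.
Proof.
move=> Lf.
pose B n : set R := `[n.+2%:R^-1, n.+2%:R]%classic.
have mB n : measurable (B n) by exact: measurable_itv.
have BH n : B n `<=` H by exact: window_half_line.
have n0 n : 0 < n.+2%:R^-1 :> R by rewrite invr_gt0.
have mhardy h : rL2 H h -> measurable_fun H (fun x => hardy k h x - h x).
  move=> Lh; under eq_fun do rewrite /hardy addrAC subrr add0r.
  apply: measurable_funN; apply: measurable_funM; last exact: measurable_prim.
  apply: measurable_funM => //; apply: measurable_continuous => y y0.
  by apply: continuous_exprz; rewrite gt_eqF.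
have Lc n c : rL2 (B n) (cst c).
  by apply: (@rL2_continuous _ _ _ n.+2%:R^-1 n.+2%:R) => // x _; exact: cst_continuous.
have LB n h : rL2 H h -> rL2 (B n) h by exact: (rL2S mH (mB n) (@BH n)).
(* A preliminary bound with a constant depending on the window. It serves only to make the
   approximation error small there; the constant 1 comes from [hardy_contraction_cpt]. *)
have hardyB n : exists2 K, 0 <= K & forall h, rL2 H h ->
    rL2 (B n) (hardy k h) /\ nrm (B n) (hardy k h) <= K * nrm H h.
  have [C C0 CP] := hardy_bound k (n0 n) (ltW (ltr_window n)).
  exists (1 + C * nrm (B n) (cst 1)); first by rewrite addr_ge0// mulr_ge0// nrm_ge0.
  move=> h Lh; have Cn0 : 0 <= C * nrm H h by rewrite mulr_ge0// nrm_ge0.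
  have [L1 N1] : rL2 (B n) (fun x => hardy k h x - h x) /\
      nrm (B n) (fun x => hardy k h x - h x) <= nrm (B n) (cst (C * nrm H h)).
    apply: (rL2_le (mB n) _ (Lc n _)).
      by apply: (@measurable_funS _ _ _ _ H); [exact: mH|exact: BH|exact: mhardy].
    by move=> x; rewrite /B /= in_itv/= => xB; rewrite [leRHS]ger0_norm// CP.
  have E : hardy k h = (fun x => h x + (hardy k h x - h x)).
    by apply/funext => x; rewrite addrC subrK.
  split; first by rewrite E; exact: rL2D (mB n) (LB n h Lh) L1.
  rewrite E; apply: (le_trans (ler_nrmD (mB n) (LB n h Lh) L1)).
  rewrite mulrDl mul1r lerD//; first exact: (sub_nrm mH (mB n) (@BH n)).
  apply: (le_trans N1); rewrite (@eq_nrm _ _ _ (fun x => (C * nrm H h) * cst 1 x)); last first.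
    by move=> x _; rewrite mulr1.
  by rewrite nrmZ// ger0_norm// mulrAC.
apply: (@rL2_exhaust _ _ B) => //.
- exact: mH.
- exact: half_line_window.
- have -> : hardy k f = (fun x => f x + (hardy k f x - f x)).
    by apply/funext => x; rewrite addrC subrK.
  by apply: measurable_funD; [case: Lf|exact: mhardy].
- by move=> n; have [K _ KP] := hardyB n; case: (KP f Lf).
apply: nearW => n; have [K K0 KP] := hardyB n.
(* With [g] a test function near [f], the norm of [hardy k f] on the window is at most
   [nrm g + K * nrm (f - g)], hence at most [nrm f + (K + 1) * nrm (f - g)]. *)
apply/ler_addgt0Pr => e e0; have K2 : 0 < K + 1 by rewrite ltr_wpDl.
have e1 : 0 < e / (K + 1) by rewrite divr_gt0.
have [_ /(_ _ e1)[g Tg fg]] := test_fun_dense [::] Lf.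
have Lg := rL2_test_fun Tg; have Lfg := rL2B mH Lf Lg.
have E : {in B n, hardy k f =1 (fun x => hardy k g x + hardy k (fun y => f y - g y) x)}.
  move=> x; rewrite inE => /BH; rewrite /half_line /= in_itv/= andbT => x0.
  have := hardy_lin k 1 x0 Lg Lfg; rewrite mul1r => <-.
  by congr (hardy k _ x); apply/funext => y; rewrite mul1r addrC subrK.
rewrite (eq_nrm E).
have [L1 N1] := KP _ Lfg; have [L2 _] := KP _ Lg.
apply: (le_trans (ler_nrmD (mB n) L2 L1)).
have [L3 N3] := hardy_contraction_cpt k (test_fun_cpt Tg).
have N2 : nrm (B n) (hardy k g) <= nrm H g by apply: le_trans N3; exact: (sub_nrm mH (mB n) (@BH n)).
have N4 : nrm H g <= nrm H f + nrm H (fun x => f x - g x).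
  apply: le_trans (ler_nrmB mH Lf Lfg); rewrite le_eqVlt; apply/orP; left; apply/eqP.
  by apply: eq_nrm => x _; rewrite opprB addrC subrK.
apply: (le_trans (lerD N2 N1)).
apply: (@le_trans _ _ (nrm H f + (K + 1) * nrm H (fun x => f x - g x))).
  by rewrite mulrDl mul1r; lra.
by rewrite lerD2l mulrC -ler_pdivlMr// ltW.
Qed.

(** * Contractions of L2 and pairs of inverse contractions *)

Record L2_contraction S : Prop := L2Contraction {
  contraction_lin : forall c f g, rL2 H f -> rL2 H g ->
    S (fun y => c * f y + g y) = (fun x => c * S f x + S g x) %[ae mu in H];
  contraction_ae : forall f g, rL2 H f -> rL2 H g ->
    f = g %[ae mu in H] -> S f = S g %[ae mu in H];
  contraction_rL2 : forall f, rL2 H f -> rL2 H (S f);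
  contraction_nrm : forall f, rL2 H f -> nrm H (S f) <= nrm H f }.

Lemma contraction_hardy k : L2_contraction (hardy k).
Proof.
split=> [c f g Lf Lg|f g Lf Lg|f Lf|f Lf].
- by apply: aeW => x; rewrite /half_line /= in_itv/= andbT => x0; exact: hardy_lin.
- move=> fg; apply: (aeS _ fg) => x fgx Hx.
  have x0 : 0 < x by move: Hx; rewrite /half_line /= in_itv/= andbT.
  by rewrite /hardy (prim_ae k x0 Lf.1 Lg.1 fg) fgx.
- by have [] := hardy_contraction k Lf.
- by have [] := hardy_contraction k Lf.
Qed.

Lemma contraction_comp S T : L2_contraction S -> L2_contraction T ->
  L2_contraction (S \o T).
Proof.
move=> [Sl Sa SL Sn] [Tl Ta TL Tn]; split.
- move=> c f g Lf Lg /=; have LTf := TL _ Lf; have LTg := TL _ Lg.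
  have Sa' := Sa _ _ (TL _ (rL2_lin c mH Lf Lg)) (rL2_lin c mH LTf LTg) (Tl c f g Lf Lg).
  by apply: (aeS2 _ Sa' (Sl c _ _ LTf LTg)) => x E1 E2 Hx; rewrite E1// E2.
- by move=> f g Lf Lg fg; apply: Sa; [exact: TL|exact: TL|exact: Ta].
- by move=> f Lf; apply/SL/TL.
- by move=> f Lf; apply: le_trans (Sn _ (TL _ Lf)) (Tn _ Lf).
Qed.

Lemma nrm_small0 f : rL2 H f -> (forall e, 0 < e -> nrm H f <= e) ->
  f = (fun=> 0) %[ae mu in H].
Proof.
move=> Lf fe; apply: (nrm_eq0 mH) => //; apply/eqP; rewrite eq_le nrm_ge0 andbT.
by apply/ler_addgt0Pr => e e0; rewrite add0r fe.
Qed.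

(** For a test function [g] near [f], [S f - f = S (f - g) - (f - g)] almost everywhere, which has
    norm at most [2 * nrm (f - g)]. *)
Lemma contraction_id S : L2_contraction S ->
  (forall g, test_fun [::] g -> {in H, S g =1 g}) ->
  forall f, rL2 H f -> S f = f %[ae mu in H].
Proof.
move=> cS Sid f Lf; have LSf := contraction_rL2 cS Lf.
suff : (fun x => S f x - f x) = (fun=> 0) %[ae mu in H].
  by apply: aeS => x E /E /eqP; rewrite subr_eq0 => /eqP.
apply: nrm_small0 => [|e e0]; first exact: (rL2B mH LSf Lf).
have e2 : 0 < e / 2 by rewrite divr_gt0.
have [_ /(_ _ e2)[g Tg fg]] := test_fun_dense [::] Lf.
have Lg := rL2_test_fun Tg; have Lfg := rL2B mH Lf Lg.
have LSfg := contraction_rL2 cS Lfg; have LSg := contraction_rL2 cS Lg.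
have E1 : S f = (fun x => S (fun y => f y - g y) x + g x) %[ae mu in H].
  have := contraction_lin cS 1 Lfg Lg.
  rewrite (_ : (fun y => 1 * (f y - g y) + g y) = f); last first.
    by apply/funext => y; rewrite mul1r subrK.
  apply: aeS => x E Hx; rewrite E// mul1r (Sid g)//; exact: mem_set.
have E2 : (fun x => S (fun y => f y - g y) x - (f x - g x)) =
    (fun x => S f x - f x) %[ae mu in H].
  by apply: aeS E1 => x E Hx; rewrite E//; ring.
have [_ ->] := rL2_ae mH (measurable_funB LSf.1 Lf.1) E2 (rL2B mH LSfg Lfg).
apply: (le_trans (ler_nrmB mH LSfg Lfg)).
by rewrite (splitr e) lerD ?ltW// (le_lt_trans (contraction_nrm cS Lfg)).
Qed.

Definition inverse_contractions S T := [/\ L2_contraction S, L2_contraction T,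
  forall f, rL2 H f -> S (T f) = f %[ae mu in H] &
  forall f, rL2 H f -> T (S f) = f %[ae mu in H]].

Lemma inverse_contractionsC S T : inverse_contractions S T -> inverse_contractions T S.
Proof. by case. Qed.

Lemma inverse_contractions_hardy k : inverse_contractions (hardy k) (hardy (- k - 1)).
Proof.
have id1 m f : rL2 H f -> hardy (- m - 1) (hardy m f) = f %[ae mu in H].
  apply: (contraction_id (contraction_comp (contraction_hardy _) (contraction_hardy _))).
  move=> g Tg x; rewrite inE /half_line /= in_itv/= andbT => x0.
  exact: hardyK_cpt (test_fun_cpt Tg) x0.
split; [exact: contraction_hardy|exact: contraction_hardy| |exact: id1].
by move=> f /(id1 (- k - 1)); rewrite (_ : - (- k - 1) - 1 = k); last lia.
Qed.

Lemma inverse_contractions_comp S T S' T' : inverse_contractions S T ->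
  inverse_contractions S' T' -> inverse_contractions (S \o S') (T' \o T).
Proof.
move=> [cS cT ST TS] [cS' cT' ST' TS']; split; try exact: contraction_comp.
- move=> f Lf /=; have LTf := contraction_rL2 cT Lf.
  have E := contraction_ae cS (contraction_rL2 cS' (contraction_rL2 cT' LTf)) LTf (ST' _ LTf).
  by apply: (aeS2 _ E (ST _ Lf)) => x E1 E2 Hx; rewrite E1// E2.
- move=> f Lf /=; have LSf := contraction_rL2 cS' Lf.
  have E := contraction_ae cT' (contraction_rL2 cT (contraction_rL2 cS LSf)) LSf (TS _ LSf).
  by apply: (aeS2 _ E (TS' _ Lf)) => x E1 E2 Hx; rewrite E1// E2.
Qed.

(** The missing inequality is [nrm f = nrm (T (S f)) <= nrm (S f)]. *)
Lemma inverse_contractions_nrm S T f : inverse_contractions S T -> rL2 H f ->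
  nrm H (S f) = nrm H f.
Proof.
move=> [cS cT ST TS] Lf; apply/eqP; rewrite eq_le (contraction_nrm cS Lf)/=.
have LSf := contraction_rL2 cS Lf.
have [_ ->] := rL2_ae mH Lf.1 (TS _ Lf) (contraction_rL2 cT LSf).
exact: contraction_nrm.
Qed.

(** Polarisation: the squared norms of [f + g] and of its image are expanded and compared. *)
Lemma inverse_contractions_dot S T f g : inverse_contractions S T ->
  rL2 H f -> rL2 H g ->
  \int[mu]_(x in H) (S f x * S g x) = \int[mu]_(x in H) (f x * g x).
Proof.
move=> ST Lf Lg; have [cS _ _ _] := ST.
have LSf := contraction_rL2 cS Lf; have LSg := contraction_rL2 cS Lg.
have Lfg := rL2_lin 1 mH Lf Lg.
have [_ E] := rL2_ae mH (rL2_lin 1 mH LSf LSg).1 (contraction_lin cS 1 Lf Lg) (contraction_rL2 cS Lfg).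
have := sqr_nrmD 1 mH LSf LSg; rewrite E (inverse_contractions_nrm ST Lfg).
rewrite (inverse_contractions_nrm ST Lf) (inverse_contractions_nrm ST Lg) (sqr_nrmD 1 mH Lf Lg).
by rewrite !mulr1; lra.
Qed.

End Extension.

Local Open Scope complex_scope.

(** * Complex functions and unitary extensions *)

Section ComplexL2.
Context {R : realType}.
Local Notation mu := (@lebesgue_measure R).
Local Notation H := (@half_line R).
Local Notation mH := (@measurable_half_line R).
Implicit Types (f g h : R -> R[i]) (u v : R -> R) (k : int) (x y : R).
Implicit Types (S T : (R -> R) -> R -> R) (U V : operator R).

Definition ReF f x : R := complex.Re (f x).
Definition ImF f x : R := complex.Im (f x).

Lemma ReM (z w : R[i]) : complex.Re (z * w) =
  complex.Re z * complex.Re w - complex.Im z * complex.Im w.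
Proof. by case: z w => a b [c d]. Qed.

Lemma ImM (z w : R[i]) : complex.Im (z * w) =
  complex.Re z * complex.Im w + complex.Im z * complex.Re w.
Proof. by case: z w => a b [c d]. Qed.

Lemma ReD (z w : R[i]) : complex.Re (z + w) = complex.Re z + complex.Re w.
Proof. by case: z w => a b [c d]. Qed.

Lemma ImD (z w : R[i]) : complex.Im (z + w) = complex.Im z + complex.Im w.
Proof. by case: z w => a b [c d]. Qed.

Lemma ReB (z w : R[i]) : complex.Re (z - w) = complex.Re z - complex.Re w.
Proof. by case: z w => a b [c d]. Qed.

Lemma ImB (z w : R[i]) : complex.Im (z - w) = complex.Im z - complex.Im w.
Proof. by case: z w => a b [c d]. Qed.

Lemma sqr_normc (z : R[i]) : ComplexField.Normc.normc z ^+ 2 =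
  complex.Re z ^+ 2 + complex.Im z ^+ 2.
Proof. by case: z => a b /=; rewrite sqr_sqrtr// addr_ge0 ?sqr_ge0. Qed.

Lemma L2P f : L2 f <-> rL2 H (ReF f) /\ rL2 H (ImF f).
Proof.
have E : (fun x => (ComplexField.Normc.normc (f x) ^+ 2)%:E) =
    (fun x => (ReF f x ^+ 2)%:E + (ImF f x ^+ 2)%:E)%E.
  by apply/funext => x; rewrite sqr_normc EFinD.
have mH' : @measurable _ (measurableTypeR R) H := mH.
split=> [[[mR mI] fin]|[[mR R2] [mI I2]]].
  have mRE : measurable_fun H (EFin \o (fun x => ReF f x ^+ 2)).
    by apply/measurable_EFinP; exact: measurable_funX.
  have mIE : measurable_fun H (EFin \o (fun x => ImF f x ^+ 2)).
    by apply/measurable_EFinP; exact: measurable_funX.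
  have I : mu.-integrable H (EFin \o (fun x => ReF f x ^+ 2 + ImF f x ^+ 2)).
    apply/integrableP; split; first by apply/measurable_EFinP; apply: measurable_funD; exact: measurable_funX.
    rewrite [X in (X < _)%E](_ : _ = \int[mu]_(x in H) ((ComplexField.Normc.normc (f x)) ^+ 2)%:E)%E//.
    by apply: eq_integral => x _ /=; rewrite sqr_normc ger0_norm// addr_ge0 ?sqr_ge0.
  by split; split=> //; apply: (@le_integrable _ (measurableTypeR R) R mu H mH' _ _ _ _ I) => // x _ /=;
    rewrite lee_fin !ger0_norm ?addr_ge0 ?sqr_ge0// ?lerDl ?lerDr sqr_ge0.
split=> //; rewrite E; have := integrable_lty mH' (integrableD mH' R2 I2).
by [].
Qed.

Lemma eqL2P f g : eqL2 f g <->
  (ReF f = ReF g %[ae mu in H]) /\ (ImF f = ImF g %[ae mu in H]).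
Proof.
split=> [fg|[Rfg Ifg]].
  by split; apply: aeS fg => x E Hx; rewrite /ReF /ImF E.
apply: (aeS2 _ Rfg Ifg) => x E1 E2 Hx; apply/eqP; rewrite eq_complex.
by apply/andP; split; apply/eqP; [exact: E1|exact: E2].
Qed.

Lemma eqL2_trans f g h : eqL2 f g -> eqL2 g h -> eqL2 f h.
Proof. by apply: aeS2 => x E1 E2 Hx; rewrite E1// E2. Qed.

Lemma eqL2_sym f g : eqL2 f g -> eqL2 g f.
Proof. by apply: aeS => x E Hx; rewrite E. Qed.

Lemma L2_lin (c : R[i]) f g : L2 f -> L2 g -> L2 (fun x => c * f x + g x).
Proof.
move=> /L2P[Rf If] /L2P[Rg Ig]; apply/L2P; split.
  have := rL2_lin (complex.Re c) mH Rf (rL2_lin (- complex.Im c) mH If Rg).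
  by apply: rL2_eq => x _; rewrite /ReF ReD ReM; ring.
have := rL2_lin (complex.Re c) mH If (rL2_lin (complex.Im c) mH Rf Ig).
by apply: rL2_eq => x _; rewrite /ImF ImD ImM; ring.
Qed.

Lemma dotL2E f g : L2 f -> L2 g -> dotL2 f g =
  (\int[mu]_(x in H) (ReF f x * ReF g x) + \int[mu]_(x in H) (ImF f x * ImF g x)) +i*
  (\int[mu]_(x in H) (ImF f x * ReF g x) - \int[mu]_(x in H) (ReF f x * ImF g x)).
Proof.
move=> /L2P[Rf If] /L2P[Rg Ig].
have I u v := @rL2_integrableM R H u v mH.
rewrite /dotL2 /cintegral; congr (_ +i* _).
  rewrite -[X in X + _]mul1r -[X in _ + X]mul1r -Rintegral_lin; [|exact: mH|exact: I|exact: I].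
  apply: eq_Rintegral => x _; rewrite ReM /ReF /ImF.
  by case: (g x) => a b /=; ring.
rewrite -[X in X - _]mul1r -[X in _ - X]mul1r -mulNr -Rintegral_lin; [|exact: mH|exact: I|exact: I].
apply: eq_Rintegral => x _; rewrite ImM /ReF /ImF.
by case: (g x) => a b /=; ring.
Qed.

(** The kernels are real, so the operators act separately on real and imaginary parts. *)
Definition complexify S f x : R[i] := S (ReF f) x +i* S (ImF f) x.

Lemma unitary_complexify S T : inverse_contractions S T -> unitaryL2 (complexify S).
Proof.
move=> ST; have [cS cT STK TSK] := ST.
have stab f : L2 f -> L2 (complexify S f).
  by move=> /L2P[Rf If]; apply/L2P; split; exact: contraction_rL2.
split=> //.
- move=> f g /L2P[Rf If] /L2P[Rg Ig] /eqL2P[Rfg Ifg].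
  by apply/eqL2P; split; apply: contraction_ae.
- move=> c f g /L2P[Rf If] /L2P[Rg Ig]; apply/eqL2P; split.
    have E := contraction_lin cS (- complex.Im c) If Rg.
    have := contraction_lin cS (complex.Re c) Rf (rL2_lin (- complex.Im c) mH If Rg).
    apply: (aeS2 _ E) => x E1 E2 Hx; rewrite /ReF ReD ReM /= -/(ReF f) -/(ImF f) -/(ReF g).
    rewrite (_ : ReF (fun y => c * f y + g y) = (fun y => complex.Re c * ReF f y + (- complex.Im c * ImF f y + ReF g y))).
      by rewrite E2// E1//; ring.
    by apply/funext => y; rewrite /ReF ReD ReM; ring.
  have E := contraction_lin cS (complex.Im c) Rf Ig.
  have := contraction_lin cS (complex.Re c) If (rL2_lin (complex.Im c) mH Rf Ig).
  apply: (aeS2 _ E) => x E1 E2 Hx; rewrite /ImF ImD ImM /= -/(ReF f) -/(ImF f) -/(ImF g).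
  rewrite (_ : ImF (fun y => c * f y + g y) = (fun y => complex.Re c * ImF f y + (complex.Im c * ReF f y + ImF g y))).
    by rewrite E2// E1//; ring.
  by apply/funext => y; rewrite /ImF ImD ImM; ring.
- move=> f g Lf Lg; rewrite !dotL2E//; last 2 first.
  + exact: stab.
  + exact: stab.
  move/L2P: Lf => [Rf If]; move/L2P: Lg => [Rg Ig].
  by rewrite !(inverse_contractions_dot ST).
- move=> g /L2P[Rg Ig]; exists (complexify T g).
    by apply/L2P; split; exact: contraction_rL2.
  by apply/eqL2P; split; exact: STK.
Qed.

Lemma complexifyK S T f : inverse_contractions S T -> L2 f ->
  eqL2 (complexify S (complexify T f)) f.
Proof.
by move=> [_ _ STK _] /L2P[Rf If]; apply/eqL2P; split; exact: STK.
Qed.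

Lemma unitary_sqr_nrm V f : unitaryL2 V -> L2 f ->
  nrm H (ReF (V f)) ^+ 2 + nrm H (ImF (V f)) ^+ 2 =
  nrm H (ReF f) ^+ 2 + nrm H (ImF f) ^+ 2.
Proof.
move=> uV Lf; have LVf := unitaryL2_stable uV Lf.
have := unitaryL2_dot uV Lf Lf; rewrite !dotL2E// => /(congr1 (@complex.Re R)) /=.
by rewrite !sqr_nrm.
Qed.

(** An arbitrary unitary [V] may mix real and imaginary parts, so each part of [V f] is controlled
    only by both parts of [f]. *)
Lemma unitary_nrm_le V f : unitaryL2 V -> L2 f ->
  nrm H (ReF (V f)) <= nrm H (ReF f) + nrm H (ImF f) /\
  nrm H (ImF (V f)) <= nrm H (ReF f) + nrm H (ImF f).
Proof.
move=> uV Lf; have E := unitary_sqr_nrm uV Lf.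
have r0 := nrm_ge0 H (ReF f); have i0 := nrm_ge0 H (ImF f).
have r0' := nrm_ge0 H (ReF (V f)); have i0' := nrm_ge0 H (ImF (V f)).
by split; rewrite -(@ler_pXn2r _ 2)// ?nnegrE ?addr_ge0//; nra.
Qed.

Definition ctest ks f := test_fun ks (ReF f) /\ test_fun ks (ImF f).

(** If [g] is a test function near [f] and [h = f - g], then [V f - W f = V h - W h] almost
    everywhere, and both terms are small because [h] is. *)
Lemma unitary_unique V W ks : unitaryL2 V -> unitaryL2 W ->
  (forall f, ctest ks f -> eqL2 (V f) (W f)) ->
  forall f, L2 f -> eqL2 (V f) (W f).
Proof.
move=> uV uW VW f Lf.
have LVf := unitaryL2_stable uV Lf; have LWf := unitaryL2_stable uW Lf.
have [RV IV] := (L2P _).1 LVf; have [RW IW] := (L2P _).1 LWf.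
have [Rf If] := (L2P _).1 Lf.
pose d x := V f x - W f x.
have small e : 0 < e -> nrm H (fun x => ReF (V f) x - ReF (W f) x) <= e /\
   nrm H (fun x => ImF (V f) x - ImF (W f) x) <= e.
  (* The two parts of [h] have norms below [e / 4]; by [unitary_nrm_le], [V h] and [W h] then
     contribute at most [e / 2] each. *)
  move=> e0; have e4 : 0 < e / 4 by rewrite divr_gt0.
  have [_ /(_ _ e4)[g1 T1 fg1]] := test_fun_dense ks Rf.
  have [_ /(_ _ e4)[g2 T2 fg2]] := test_fun_dense ks If.
  pose g x : R[i] := g1 x +i* g2 x.
  have Lg : L2 g by apply/L2P; split; [exact: rL2_test_fun T1|exact: rL2_test_fun T2].
  pose h x := -1 * g x + f x.
  have Lh : L2 h by exact: L2_lin.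
  have E U : unitaryL2 U -> eqL2 (U f) (fun x => U h x + U g x).
    move=> uU; have := unitaryL2_linear uU 1 Lh Lg.
    rewrite (_ : (fun x => 1 * h x + g x) = f); last first.
      by apply/funext => x; rewrite /h; ring.
    by apply: aeS => x E Hx; rewrite E// mul1r.
  have hR : nrm H (ReF h) = nrm H (fun x => ReF f x - g1 x).
    by apply: eq_nrm => x _; rewrite /ReF /h ReD ReM /=; ring.
  have hI : nrm H (ImF h) = nrm H (fun x => ImF f x - g2 x).
    by apply: eq_nrm => x _; rewrite /ImF /h ImD ImM /=; ring.
  have LVh := unitaryL2_stable uV Lh; have LWh := unitaryL2_stable uW Lh.
  have [RVh IVh] := (L2P _).1 LVh; have [RWh IWh] := (L2P _).1 LWh.
  have Eh : eqL2 (fun x => V h x - W h x) (fun x => V f x - W f x).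
    have Eg : eqL2 (V g) (W g) by apply: VW.
    have := aeS2 (fun x a b => conj a b) (E V uV) (E W uW).
    by apply: (aeS2 _ Eg) => x E1 [E2 E3] Hx; rewrite E2// E3// E1//; ring.
  have [NV1 NV2] := unitary_nrm_le uV Lh; have [NW1 NW2] := unitary_nrm_le uW Lh.
  have [ER EI] := (eqL2P _ _).1 Eh.
  have sum_le : nrm H (ReF h) + nrm H (ImF h) <= e / 2.
    by rewrite hR hI; lra.
  split.
    have E1 : (fun x => ReF (V h) x - ReF (W h) x) =
        (fun x => ReF (V f) x - ReF (W f) x) %[ae mu in H].
      by apply: aeS ER => x E1 Hx; have := E1 Hx; rewrite /ReF !ReB.
    have [_ ->] := rL2_ae mH (measurable_funB RV.1 RW.1) E1 (rL2B mH RVh RWh).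
    by apply: (le_trans (ler_nrmB mH RVh RWh)); lra.
  have E1 : (fun x => ImF (V h) x - ImF (W h) x) =
      (fun x => ImF (V f) x - ImF (W f) x) %[ae mu in H].
    by apply: aeS EI => x E1 Hx; have := E1 Hx; rewrite /ImF !ImB.
  have [_ ->] := rL2_ae mH (measurable_funB IV.1 IW.1) E1 (rL2B mH IVh IWh).
  by apply: (le_trans (ler_nrmB mH IVh IWh)); lra.
apply/eqL2P; split.
  have := nrm_small0 (rL2B mH RV RW) (fun e e0 => (small e e0).1).
  by apply: aeS => x E /E /eqP; rewrite subr_eq0 => /eqP.
have := nrm_small0 (rL2B mH IV IW) (fun e e0 => (small e e0).2).
by apply: aeS => x E /E /eqP; rewrite subr_eq0 => /eqP.
Qed.

(* In the instances [Ur u - S u] is a combination of fixed functions, none of them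
   square integrable, with the moments [ks] of [u] as coefficients. *)
Record realizes U (Ur S : (R -> R) -> R -> R) (ks : seq int) : Prop := Realizes {
  realizes_re : forall f x, 0 < x -> U f x = Ur (ReF f) x +i* Ur (ImF f) x;
  realizes_eq : forall u x, continuous_cpt u -> 0 < x ->
    (forall k, k \in ks -> moment k u = 0) -> Ur u x = S u x;
  realizes_moment : forall u, continuous_cpt u ->
    rL2 H (fun x => Ur u x - S u x) -> forall k, k \in ks -> moment k u = 0 }.

(** For [f] in the domain of [U] the difference of [U f] and [complexify S f] is in L2, so the
    moments of both parts of [f] vanish, and then the two functions agree at every positive
    point. *)
Lemma realizes_ext U Ur S T ks : realizes U Ur S ks -> inverse_contractions S T ->
  unitary_extension U (complexify S).
Proof.
move=> [Ure Ueq Umom] ST; split; first exact: unitary_complexify ST.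
have [cS _ _ _] := ST.
move=> f [[sR sI [a [b [a0 fab]]]] LU].
have cR : continuous_cpt (ReF f).
  split; first exact: smooth_continuous.
  exists a, b; split=> // x fx; apply: fab; apply: contraNneq fx => fx0.
  by rewrite /ReF fx0.
have cI : continuous_cpt (ImF f).
  split; first exact: smooth_continuous.
  exists a, b; split=> // x fx; apply: fab; apply: contraNneq fx => fx0.
  by rewrite /ImF fx0.
have pos x : H x -> 0 < x by rewrite /half_line /= in_itv/= andbT.
have [LR LI] := (L2P _).1 LU.
have eR : {in H, ReF (U f) =1 Ur (ReF f)}.
  by move=> x; rewrite inE => /pos x0; rewrite /ReF Ure.
have eI : {in H, ImF (U f) =1 Ur (ImF f)}.
  by move=> x; rewrite inE => /pos x0; rewrite /ImF Ure.
have mR := Umom _ cR (rL2B mH (rL2_eq eR LR) (contraction_rL2 cS (rL2_cpt cR))).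
have mI := Umom _ cI (rL2B mH (rL2_eq eI LI) (contraction_rL2 cS (rL2_cpt cI))).
by apply: aeW => x /pos x0; rewrite Ure// /complexify !Ueq.
Qed.

(** Vanishing moments make [U f] equal to the L2 function [complexify S f]; the domain of [U] thus
    contains a dense set, on which [realizes_unique] relies. *)
Lemma realizes_domain U Ur S T ks f : realizes U Ur S ks ->
  inverse_contractions S T -> ctest ks f -> in_domain U f.
Proof.
move=> [Ure Ueq Umom] [cS _ _ _] [TR TI].
have pos x : H x -> 0 < x by rewrite /half_line /= in_itv/= andbT.
have cR := test_fun_cpt TR; have cI := test_fun_cpt TI.
have [sR [a [b [a0 Rab]]] mR] := TR; have [sI [a' [b' [a'0 Iab]]] mI] := TI.
split.
  split; [exact: flat_algebra_smooth|exact: flat_algebra_smooth|].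
  exists (Num.min a a'), (Num.max b b'); split; first by rewrite lt_min a0.
  move=> x; rewrite ge_min le_max.
  have [E|/Rab/andP[-> ->]//] := eqVneq (ReF f x) 0.
  have [E'|/Iab/andP[-> ->]] := eqVneq (ImF f x) 0; last by rewrite !orbT.
  by rewrite eq_complex /= -/(ReF f x) -/(ImF f x) E E' !eqxx.
apply/L2P; split.
  apply: rL2_eq (contraction_rL2 cS (rL2_cpt cR)) => x; rewrite inE => /pos x0.
  by rewrite -[RHS]/(complex.Re (U f x)) Ure//= Ueq.
apply: rL2_eq (contraction_rL2 cS (rL2_cpt cI)) => x; rewrite inE => /pos x0.
by rewrite -[RHS]/(complex.Im (U f x)) Ure//= Ueq.
Qed.

Lemma realizes_unique U Ur S T ks V : realizes U Ur S ks ->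
  inverse_contractions S T -> unitary_extension U V ->
  forall f, L2 f -> eqL2 (V f) (complexify S f).
Proof.
move=> rU ST [uV VU]; apply: (@unitary_unique _ _ ks) => //.
  exact: unitary_complexify ST.
move=> f cf; have Df := realizes_domain rU ST cf.
by apply: (eqL2_trans (VU f Df)); apply/eqL2_sym; apply: (realizes_ext rU ST).2.
Qed.

Lemma realizes_mutually_inverse U Ur S ks U' Ur' S' ks' :
  realizes U Ur S ks -> realizes U' Ur' S' ks' -> inverse_contractions S S' ->
  unitary_mutually_inverse U U'.
Proof.
move=> rU rU' SS'; have S'S := inverse_contractionsC SS'; split.
- by exists (complexify S); exact: realizes_ext rU SS'.
- by exists (complexify S'); exact: realizes_ext rU' S'S.
have inv V V' (X Y : (R -> R) -> R -> R) : inverse_contractions X Y ->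
    unitaryL2 V -> unitaryL2 V' ->
    (forall f, L2 f -> eqL2 (V f) (complexify X f)) ->
    (forall f, L2 f -> eqL2 (V' f) (complexify Y f)) ->
    forall f, L2 f -> eqL2 (V (V' f)) f.
  move=> XY uV uV' VX VY f Lf; have uY := unitary_complexify (inverse_contractionsC XY).
  have LYf := unitaryL2_stable uY Lf; have LVf := unitaryL2_stable uV' Lf.
  apply: (eqL2_trans (unitaryL2_eq uV LVf LYf (VY _ Lf))).
  exact: (eqL2_trans (VX _ LYf) (complexifyK XY Lf)).
move=> V V' EV EV' f Lf; have VS := realizes_unique rU SS' EV.
have VS' := realizes_unique rU' S'S EV'.
split; first exact: (inv _ _ _ _ SS' EV.1 EV'.1 VS VS' f Lf).
exact: (inv _ _ _ _ S'S EV'.1 EV.1 VS' VS f Lf).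
Qed.

End ComplexL2.

(** * The operators U3, ..., U10 *)

Section Kernels.
Context {R : realType}.
Local Notation mu := (@lebesgue_measure R).
Local Notation H := (@half_line R).
Local Notation mH := (@measurable_half_line R).
Implicit Types (f g h : R -> R[i]) (u v d : R -> R) (k : int) (x y : R).

(** The block [[r, 2r]] has length [r]. It is moved to infinity when [|d|] is bounded below there,
    and to 0 when [|d|] is at least of order 1/x. *)
Lemma sqr_nrm_ge d r m : 0 < r -> 0 <= m -> rL2 H d ->
  (forall x, r <= x <= 2 * r -> m <= `|d x|) -> m ^+ 2 * r <= nrm H d ^+ 2.
Proof.
move=> r0 m0 Ld dm; pose A : set R := `[r, 2 * r]%classic.
have mA : measurable A by exact: measurable_itv.
have AH : A `<=` H.
  by move=> x; rewrite /A /half_line /= !in_itv/= andbT => /andP[+ _]; exact: lt_le_trans.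
have Lm : rL2 A (cst m).
  by apply: (@rL2_continuous _ _ _ r (2 * r)) => // x _; exact: cst_continuous.
have [_ N1] := rL2_le mA Lm.1 (rL2S mH mA AH Ld)
  (fun x Ax => eq_ind_r (fun z => z <= _) (dm x Ax) (ger0_norm m0)).
have N2 := sub_nrm mH mA AH Ld.
have -> : m ^+ 2 * r = nrm A (cst m) ^+ 2.
  have mA' : @measurable _ (measurableTypeR R) A := mA.
  rewrite sqr_nrm; transitivity (\int[mu]_(x in A) (m ^+ 2)); last by [].
  rewrite (Rintegral_cst mu mA' (m ^+ 2)); congr (_ * _).
  transitivity (fine (2 * r - r)%:E); first by rewrite /=; ring.
  congr fine; apply/esym; apply: etrans (lebesgue_measure_itv _) _.
  by rewrite /= lte_fin ltr_pMl// ltr1n.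
by rewrite lerXn2r ?nnegrE ?nrm_ge0// (le_trans N1).
Qed.

Lemma norm_affine_pow (A B : R) n : ~ (A = 0 /\ B = 0) ->
  exists c t, [/\ 0 < c, 1 <= t & forall y, t <= y -> c <= `|A + B * y ^+ n.+1|].
Proof.
move=> AB; have [B0|B0] := eqVneq B 0.
  have A0 : A != 0 by apply/eqP => A0; apply: AB.
  by exists `|A|, 1; split=> // [|y _]; rewrite ?normr_gt0// B0 mul0r addr0.
have nB : 0 < `|B| by rewrite normr_gt0.
(* Beyond this threshold [|B| * y >= |A| + 1], and [y ^ n.+1 >= y] because [y >= 1]. *)
exists 1, (Num.max 1 ((`|A| + 1) / `|B|)); split; rewrite ?ltr01 ?le_max ?lexx//.
move=> y; rewrite ge_max ler_pdivrMr// => /andP[y1 yA].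
rewrite addrC; apply: le_trans (lerB_normD _ _).
rewrite normrM normrX (ger0_norm (le_trans ler01 y1)) lerBrDr.
rewrite addrC; apply: (le_trans yA); rewrite mulrC ler_wpM2l ?normr_ge0//.
by rewrite exprS ler_peMr ?exprn_ege1// (le_trans ler01).
Qed.

Lemma vanish_pinfty d A B n : rL2 H d ->
  (forall x, 0 < x -> d x = A + B * x ^+ n.+1) -> A = 0 /\ B = 0.
Proof.
move=> Ld dE; apply: contrapT => /(@norm_affine_pow A B n)[c [t [c0 t1 ct]]].
(* Large enough for [c ^ 2 * r] to exceed [nrm d ^ 2]. *)
pose r := t + (nrm H d ^+ 2 + 1) / c ^+ 2.
have N0 : 0 < nrm H d ^+ 2 + 1 by rewrite ltr_wpDl ?sqr_ge0.
have c20 : 0 < c ^+ 2 by rewrite exprn_gt0.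
have tr : t <= r by rewrite lerDl divr_ge0// ltW.
have r0 : 0 < r by rewrite (lt_le_trans ltr01)// (le_trans t1).
suff /(@sqr_nrm_ge d r c r0 (ltW c0) Ld) : forall x, r <= x <= 2 * r -> c <= `|d x|.
  rewrite leNgt => /negP; apply; rewrite -ltr_pdivrMl// mulrC.
  apply: (@lt_le_trans _ _ ((nrm H d ^+ 2 + 1) / c ^+ 2)).
    by rewrite ltr_pM2r ?invr_gt0// ltrDl.
  by rewrite lerDr (le_trans ler01).
move=> x /andP[rx _]; rewrite dE ?(lt_le_trans r0)// ct// (le_trans tr)//.
Qed.

Lemma vanish_zero d A B n : rL2 H d ->
  (forall x, 0 < x -> d x = x^-1 * (A + B * x^-1 ^+ n.+1)) -> A = 0 /\ B = 0.
Proof.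
move=> Ld dE; apply: contrapT => /(@norm_affine_pow A B n)[c [t [c0 t1 ct]]].
have N0 : 0 < nrm H d ^+ 2 + 1 by rewrite ltr_wpDl ?sqr_ge0.
have t0 : 0 < t by rewrite (lt_le_trans ltr01).
have c20 : 0 < c ^+ 2 by rewrite exprn_gt0.
(* On the block from [1/(2s)] to [1/s] one has [|d x| >= c * s], so the squared norm is at least
   [c ^ 2 * s / 2]; this [s] makes that exceed [nrm d ^ 2]. *)
pose s := t + (nrm H d ^+ 2 + 1) * 2 / c ^+ 2.
have ts : t <= s by rewrite lerDl divr_ge0 ?mulr_ge0 ?(ltW N0)// ltW.
have s0 : 0 < s by rewrite (lt_le_trans t0).
have r0 : 0 < (2 * s)^-1 by rewrite invr_gt0 mulr_gt0.
have cs0 : 0 <= c * s by rewrite mulr_ge0// ltW.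
suff /(@sqr_nrm_ge d (2 * s)^-1 (c * s) r0 cs0 Ld) :
    forall x, (2 * s)^-1 <= x <= 2 * (2 * s)^-1 -> c * s <= `|d x|.
  rewrite leNgt => /negP; apply.
  have -> : (c * s) ^+ 2 / (2 * s) = s * (c ^+ 2 / 2) by field; rewrite gt_eqF.
  rewrite -ltr_pdivrMr ?divr_gt0// invf_div mulrA.
  apply: (@lt_le_trans _ _ ((nrm H d ^+ 2 + 1) * 2 / c ^+ 2)).
    by rewrite ltr_pM2r ?invr_gt0// ltr_pM2r// ltrDl.
  by rewrite lerDr ltW.
move=> x /andP[rx xr]; have x0 := lt_le_trans r0 rx.
have xs : s <= x^-1.
  rewrite -[leLHS]invrK lef_pV2 ?posrE ?invr_gt0//; apply: (le_trans xr).
  by rewrite invfM mulrA mulfV// mul1r.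
rewrite dE// normrM (ger0_norm (ltW _)) ?invr_gt0// mulrC ler_pM ?(ltW s0) ?(ltW c0)//.
by rewrite ct// (le_trans ts).
Qed.

(** * The eight operators in real and imaginary coordinates *)

Lemma cintegral_kernel (D : set R) (w : R -> R) f :
  cintegral D (fun y => (w y)%:C * f y) =
  (\int[mu]_(y in D) (w y * ReF f y)) +i* (\int[mu]_(y in D) (w y * ImF f y)).
Proof.
rewrite /cintegral; congr (_ +i* _); apply: eq_Rintegral => y _.
  by rewrite /ReF; case: (f y) => a b /=; rewrite mul0r subr0.
by rewrite /ImF; case: (f y) => a b /=; rewrite mul0r addr0.
Qed.

Lemma add_scale_complex (z : R[i]) (c a b : R) :
  z + c%:C * (a +i* b) = (complex.Re z + c * a) +i* (complex.Im z + c * b).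
Proof. by case: z => p q; apply/eqP; rewrite eq_complex /= !mul0r subr0 addr0 !eqxx. Qed.

Lemma sub_scale_complex (z : R[i]) (c a b : R) :
  z - c%:C * (a +i* b) = (complex.Re z - c * a) +i* (complex.Im z - c * b).
Proof. by case: z => p q; apply/eqP; rewrite eq_complex /= !mul0r subr0 addr0 !eqxx. Qed.

Definition below k u x := \int[mu]_(y in `]0, x[) (y ^ k * u y).

Lemma aboveE k u x : continuous_cpt u -> 0 < x ->
  \int[mu]_(y in `]x, +oo[) (y ^ k * u y) = moment k u - below k u x.
Proof. exact: Rintegral_tail_above. Qed.

Lemma prim_below k u x : continuous_cpt u -> 0 < x ->
  prim k u x = below k u x - (if k < 0 then moment k u else 0).
Proof. exact: primE. Qed.

(** [U3] integrates from 0 and [prim (-1)] towards infinity; the discrepancy is the constant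
    [moment (-1) u], which is in L2 only if it is 0. *)
Lemma realizes_U3 : exists Ur, realizes (@U3 R) Ur (hardy (-1)) [:: -1].
Proof.
pose Ur u x := u x + below (-1) u x.
have E u x : continuous_cpt u -> 0 < x -> Ur u x - hardy (-1) u x = moment (-1) u.
  by move=> cu x0; rewrite /Ur /hardy prim_below//= expr0z; ring.
exists Ur; split.
- move=> f x x0; rewrite /U3 cintegral_kernel -[X in _ + X]mul1r.
  by rewrite (_ : 1 = 1%:C)// add_scale_complex !mul1r.
- move=> u x cu x0 mu0; apply/eqP; rewrite -subr_eq0 E// mu0// inE//.
- move=> u cu Ld k; rewrite inE => /eqP ->.
  have [x x0|//] := @vanish_pinfty _ (moment (-1) u) 0 0 Ld.
  by rewrite mul0r addr0 E.
Qed.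

Lemma realizes_U4 : exists Ur, realizes (@U4 R) Ur (hardy 0) [:: 0].
Proof.
pose Ur u x := u x + x^-1 * \int[mu]_(y in `]x, +oo[) (y ^ 0 * u y).
have E u x : continuous_cpt u -> 0 < x -> Ur u x - hardy 0 u x = x^-1 * moment 0 u.
  by move=> cu x0; rewrite /Ur /hardy prim_below// aboveE//= subr0 (_ : x ^ (- 0 - 1) = x^-1)//; ring.
exists Ur; split.
- move=> f x x0; rewrite /U4 (_ : cintegral _ f = cintegral `]x, +oo[ (fun y => (y ^ 0)%:C * f y)).
    by rewrite cintegral_kernel add_scale_complex.
  by congr cintegral; apply/funext => y; rewrite expr0z mul1r.
- by move=> u x cu x0 mu0; apply/eqP; rewrite -subr_eq0 E// mu0 ?inE// mulr0.
- move=> u cu Ld k; rewrite inE => /eqP ->.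
  have [x x0|//] := @vanish_zero _ (moment 0 u) 0 0 Ld.
  by rewrite mul0r addr0 E.
Qed.

Lemma realizes_U5 : exists Ur, realizes (@U5 R) Ur (hardy (-2)) [:: -2].
Proof.
pose Ur u x := u x + 3 * x * below (-2) u x.
have E u x : continuous_cpt u -> 0 < x -> Ur u x - hardy (-2) u x = 3 * x * moment (-2) u.
  by move=> cu x0; rewrite /Ur /hardy prim_below//= expr1z; ring.
exists Ur; split.
- by move=> f x x0; rewrite /U5 cintegral_kernel add_scale_complex.
- by move=> u x cu x0 mu0; apply/eqP; rewrite -subr_eq0 E// mu0 ?inE// mulr0.
- move=> u cu Ld k; rewrite inE => /eqP ->.
  have [|_] := @vanish_pinfty _ 0 (3 * moment (-2) u) 0 Ld.
    by move=> x x0; rewrite add0r E// expr1; ring.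
  by move=> /eqP; rewrite mulf_eq0 pnatr_eq0 => /eqP.
Qed.

(** [U6] and [prim 1] integrate from the same end, so no moment appears. *)
Lemma realizes_U6 : exists Ur, realizes (@U6 R) Ur (hardy 1) [::].
Proof.
pose Ur u x := u x - 3 / x ^+ 2 * below 1 u x.
exists Ur; split=> //.
- by move=> f x x0; rewrite /U6 cintegral_kernel sub_scale_complex.
- by move=> u x cu x0 _; rewrite /Ur /hardy prim_below//= subr0.
Qed.

(** The excess over [hardy 1] is a multiple of [x^-2], which is not square integrable at 0. *)
Lemma realizes_U7 : exists Ur, realizes (@U7 R) Ur (hardy 1) [:: 1].
Proof.
pose Ur u x := u x + 3 / x ^+ 2 * \int[mu]_(y in `]x, +oo[) (y ^ 1 * u y).
have E u x : continuous_cpt u -> 0 < x -> Ur u x - hardy 1 u x = 3 / x ^+ 2 * moment 1 u.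
  move=> cu x0; rewrite /Ur /hardy prim_below// aboveE//= subr0.
  by rewrite (_ : x ^ (-1 - 1) = (x ^+ 2)^-1)//; ring.
exists Ur; split.
- by move=> f x x0; rewrite /U7 cintegral_kernel add_scale_complex.
- by move=> u x cu x0 mu0; apply/eqP; rewrite -subr_eq0 E// mu0 ?inE// mulr0.
- move=> u cu Ld k; rewrite inE => /eqP ->.
  have [|_] := @vanish_zero _ 0 (3 * moment 1 u) 0 Ld.
    by move=> x x0; rewrite add0r E// expr1 expr2 invfM; ring.
  by move=> /eqP; rewrite mulf_eq0 pnatr_eq0 => /eqP.
Qed.

(** [U8] and [prim (-2)] both integrate towards infinity, so no moment appears. *)
Lemma realizes_U8 : exists Ur, realizes (@U8 R) Ur (hardy (-2)) [::].
Proof.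
pose Ur u x := u x - 3 * x * \int[mu]_(y in `]x, +oo[) (y ^ (-2) * u y).
exists Ur; split=> //.
- by move=> f x x0; rewrite /U8 cintegral_kernel sub_scale_complex.
- by move=> u x cu x0 _; rewrite /Ur /hardy prim_below// aboveE//= expr1z; ring.
Qed.

Lemma Rintegral_below2 (a b : R) k m u x : continuous_cpt u -> 0 < x ->
  \int[mu]_(y in `]0, x[) ((a * y ^ k + b * y ^ m) * u y) =
  a * below k u x + b * below m u x.
Proof.
move=> cu x0; have sub := (itv_half_line true x).1.
rewrite -Rintegral_lin; [|exact: measurable_itv| |].
- by apply: eq_Rintegral => y _; ring.
- by apply: integrable_half_lineS sub (integrable_cpt k cu).
- by apply: integrable_half_lineS sub (integrable_cpt m cu).
Qed.

Lemma Rintegral_above2 (a b : R) k m u x : continuous_cpt u -> 0 < x ->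
  \int[mu]_(y in `]x, +oo[) ((a * y ^ k + b * y ^ m) * u y) =
  a * (moment k u - below k u x) + b * (moment m u - below m u x).
Proof.
move=> cu x0; have sub : `]x, +oo[%classic `<=` H.
  by move=> y; rewrite /half_line /= !in_itv/= !andbT; exact: lt_trans.
rewrite -!aboveE// -Rintegral_lin; [|exact: measurable_itv| |].
- by apply: eq_Rintegral => y _; ring.
- by apply: integrable_half_lineS sub (integrable_cpt k cu).
- by apply: integrable_half_lineS sub (integrable_cpt m cu).
Qed.

(** For [k = -3] and [m = -1] the factor [(k+m+1)/(k-m)] of [hardy_hardy_cpt] is 3/2; multiplied by
    [2m+1 = -1] and by [-(2k+1) = 5] it gives -3/2 and 15/2. *)
Lemma realizes_U9 :
  exists Ur, realizes (@U9 R) Ur (hardy (-3) \o hardy (-1)) [:: -3; -1].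
Proof.
pose w x y : R := 15 * x ^+ 2 / y ^+ 3 - 3 / y.
pose Ur u x := u x + 2^-1 * \int[mu]_(y in `]0, x[) (w x y * u y).
have E u x : continuous_cpt u -> 0 < x -> Ur u x - (hardy (-3) \o hardy (-1)) u x =
    - (3 / 2) * moment (-1) u + 15 / 2 * moment (-3) u * x ^+ 2.
  move=> cu x0; rewrite /Ur /= hardy_hardy_cpt// !prim_below//=.
  have -> : \int[mu]_(y in `]0, x[) (w x y * u y) =
      15 * x ^+ 2 * below (-3) u x + - 3 * below (-1) u x.
    rewrite -Rintegral_below2//; apply: eq_Rintegral => y _.
    by rewrite /w mulNr.
  rewrite (_ : x ^ (- - 1 - 1) = 1)// (_ : x ^ (- - 3 - 1) = x ^+ 2)//.
  by rewrite /=; field.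
exists Ur; split.
- by move=> f x x0; rewrite /U9 cintegral_kernel add_scale_complex.
- move=> u x cu x0 mu0; apply/eqP; rewrite -subr_eq0 E// !mu0 ?inE ?eqxx ?orbT//.
  by rewrite !mulr0 mul0r addr0.
- move=> u cu Ld.
  have [x x0|] := @vanish_pinfty _ (- (3 / 2) * moment (-1) u) (15 / 2 * moment (-3) u) 1 Ld.
    by rewrite E.
  move=> m1 m3 k; rewrite !inE => /orP[/eqP->|/eqP->]; lra.
Qed.

(** For [k = 0] and [m = 2] the factor is -3/2, with [2m+1 = 5] and [-(2k+1) = -1]. The excess is a
    combination of [x^-1] and [x^-3], tested at 0. *)
Lemma realizes_U10 :
  exists Ur, realizes (@U10 R) Ur (hardy 0 \o hardy 2) [:: 0; 2].
Proof.
pose w x y : R := 15 * y ^+ 2 / x ^+ 3 - 3 / x.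
pose Ur u x := u x + 2^-1 * \int[mu]_(y in `]x, +oo[) (w x y * u y).
have E u x : continuous_cpt u -> 0 < x -> Ur u x - (hardy 0 \o hardy 2) u x =
    x^-1 * (- (3 / 2) * moment 0 u + 15 / 2 * moment 2 u * x^-1 ^+ 2).
  move=> cu x0; have xn0 : x != 0 by rewrite gt_eqF.
  rewrite /Ur /= hardy_hardy_cpt// !prim_below//=.
  have -> : \int[mu]_(y in `]x, +oo[) (w x y * u y) =
      15 / x ^+ 3 * (moment 2 u - below 2 u x) + - (3 / x) * (moment 0 u - below 0 u x).
    rewrite -Rintegral_above2//; apply: eq_Rintegral => y _.
    by rewrite /w expr0z mulr1 mulrAC.
  rewrite (_ : x ^ (- 0 - 1) = x^-1)// (_ : x ^ (- 2 - 1) = (x ^+ 3)^-1)//.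
  by rewrite /=; field.
exists Ur; split.
- by move=> f x x0; rewrite /U10 cintegral_kernel add_scale_complex.
- move=> u x cu x0 mu0; apply/eqP; rewrite -subr_eq0 E// !mu0 ?inE ?eqxx ?orbT//.
  by rewrite !mulr0 mul0r addr0 mulr0.
- move=> u cu Ld.
  have [x x0|] := @vanish_zero _ (- (3 / 2) * moment 0 u) (15 / 2 * moment 2 u) 1 Ld.
    by rewrite E.
  move=> m1 m3 k; rewrite !inE => /orP[/eqP->|/eqP->]; lra.
Qed.

End Kernels.

Theorem theorem23 (R : realType) :
  [/\ unitary_mutually_inverse (@U3 R) (@U4 R),
      unitary_mutually_inverse (@U5 R) (@U6 R),
      unitary_mutually_inverse (@U7 R) (@U8 R) &
      unitary_mutually_inverse (@U9 R) (@U10 R)].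
Proof.
have [? r3] := @realizes_U3 R; have [? r4] := @realizes_U4 R.
have [? r5] := @realizes_U5 R; have [? r6] := @realizes_U6 R.
have [? r7] := @realizes_U7 R; have [? r8] := @realizes_U8 R.
have [? r9] := @realizes_U9 R; have [? r10] := @realizes_U10 R.
have inv := @inverse_contractions_hardy R.
split.
(* The index [- k - 1] of the inverse reduces by computation: -1 to 0, -2 to 1, 1 to -2. *)
- exact: realizes_mutually_inverse r3 r4 (inv (-1)).
- exact: realizes_mutually_inverse r5 r6 (inv (-2)).
- exact: realizes_mutually_inverse r7 r8 (inv 1).
(* Inverting the product reverses its order: [hardy 0] inverts [hardy (-1)] and [hardy 2] inverts
   [hardy (-3)]. *)
- apply: realizes_mutually_inverse r9 r10 _.
  exact: inverse_contractions_comp (inv (-3)) (inv (-1)).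
Qed.
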